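(* Let $n\ge 2$ and let $u\in h(\mathbb{R}^n)$ be a harmonic function on $\mathbb{R}^n$ such that $A_2(r,u)\le\varphi(r)$, where $\varphi$ is a monotonic increasing function on $[0,\infty)$. Assume that $A_2(x_m,r_m,u)\le\varepsilon_m$ for $m\in\mathbb{N}$, where $x_m\in\mathbb{R}^n$ and $0<2r_m\le|x_m|$. If $$\lim_{m\to\infty}\left[\frac{\rho_m}{100}\log\varepsilon_m+\varphi(4|x_m|)\right]=-\infty,\qquad\text{where }\rho_m=\frac{1}{\log\frac{2|x_m|}{r_m}},$$ then $u\equiv 0$ in $\mathbb{R}^n$.
   Context: $h(\mathbb{R}^n)$ denotes the space of harmonic functions on $\mathbb{R}^n$. $B_{x,r}$ is the open ball in $\mathbb{R}^n$ with center $x$ and radius $r$, and $\nu$ is $n$-dimensional Lebesgue measure. The normalized means are $$A_2(x,r,u):=\left(\frac{1}{\nu(B_{x,r})}\int_{B_{x,r}}|u|^2\,d\nu\right)^{1/2},\qquad A_2(r,u):=A_2(0,r,u).$$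
   Formalization: The formal theorem adds the assumption that the centres x_m do not converge to 0; without it the claim is false (n=2, u = first coordinate, φ(r)=r, x_m=(e^{-m}/2)e_1, r_m=|x_m|/2, ε_m=e^{-m}). *)

(* Defs.v *)
From HB Require Import structures.
From mathcomp Require Import all_boot all_order all_algebra.
From mathcomp Require Import all_classical all_reals all_analysis.

Set Implicit Arguments.
Unset Strict Implicit.
Unset Printing Implicit Defensive.

Import Order.TTheory GRing.Theory Num.Theory.
Import numFieldNormedType.Exports.

Local Open Scope classical_set_scope.
Local Open Scope ring_scope.

(* The library's norm on matrices is the maximum norm (it induces the same
   topology), hence the separate Euclidean norm and balls. *)
Definition enorm {R : realType} {n : nat} (x : 'rV[R]_n) : R :=
  Num.sqrt (\sum_(i < n) x ord0 i ^+ 2).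

Definition eball {R : realType} {n : nat} (x : 'rV[R]_n) (r : R)
  : set 'rV[R]_n := [set y | enorm (y - x) < r].

Definition partial {R : realType} {n : nat} (i : 'I_n) (f : 'rV[R]_n -> R)
  : 'rV[R]_n -> R := fun x => 'D_(delta_mx ord0 i) f x.

Definition has_partial {R : realType} {n : nat} (i : 'I_n)
  (f : 'rV[R]_n -> R) : Prop := forall x, derivable f x (delta_mx ord0 i).

Definition twice_continuously_differentiable {R : realType} {n : nat}
    (f : 'rV[R]_n -> R) : Prop :=
  [/\ continuous f,
      forall i, has_partial i f /\ continuous (partial i f) &
      forall i j, has_partial j (partial i f) /\
                  continuous (partial j (partial i f))].

Definition laplacian {R : realType} {n : nat} (f : 'rV[R]_n -> R)
  : 'rV[R]_n -> R := fun x => \sum_(i < n) partial i (partial i f) x.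

Definition harmonic_on_Rn {R : realType} {n : nat} (f : 'rV[R]_n -> R) : Prop :=
  twice_continuously_differentiable f /\ forall x, laplacian f x = 0.

Definition rV_display : measure_display.
Proof. exact: default_measure_display. Qed.

(* R^n carries the sigma-algebra generated by the coordinate maps, i.e. the
   product of the Borel sigma-algebras of the n factors; it is the Borel
   sigma-algebra of R^n. *)
Section measurable_rV.
Variables (R : realType) (n : nat).

Let coor : 'I_n -> 'rV[R]_n -> measurableTypeR R := fun i x => x ord0 i.

Let rV_set0 : g_sigma_preimage coor set0.
Proof. exact: sigma_algebra0. Qed.

Let rV_setC A : g_sigma_preimage coor A -> g_sigma_preimage coor (~` A).
Proof. exact: sigma_algebraC. Qed.

Let rV_bigcup (F : (set 'rV[R]_n)^nat) :
  (forall i, g_sigma_preimage coor (F i)) ->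
  g_sigma_preimage coor (\bigcup_i (F i)).
Proof. exact: sigma_algebra_bigcup. Qed.

HB.instance Definition _ := @isMeasurable.Build
  rV_display 'rV[R]_n
  (g_sigma_preimage coor) rV_set0 rV_setC rV_bigcup.

End measurable_rV.

Lemma measurable_coor {R : realType} {n : nat} (i : 'I_n) :
  measurable_fun setT (fun x : 'rV[R]_n => x ord0 i : measurableTypeR R).
Proof.
move=> _ Y mY; rewrite setTI; apply: sub_sigma_algebra => /=.
rewrite -bigcup_seq/=; exists i => /=; first by rewrite mem_index_enum.
by exists Y => //; rewrite setTI.
Qed.

Lemma measurable_fun_rVP {R : realType} {d} {T : measurableType d} {n : nat}
    (f : T -> 'rV[R]_n) :
  (forall i, measurable_fun setT (fun t => f t ord0 i : measurableTypeR R)) ->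
  measurable_fun setT f.
Proof.
move=> mf _ A mA; rewrite setTI.
pose c := fun (i : 'I_n) (x : 'rV[R]_n) => x ord0 i : measurableTypeR R.
suff: g_sigma_preimage (fun i => c i \o f) `<=` measurable.
  by rewrite g_sigma_preimage_comp; apply; exists A; rewrite ?setTI.
apply: smallest_sub; first exact: sigma_algebra_measurable.
rewrite -bigcup_seq; apply: bigcup_sub => i _ _ [B mB <-]; exact: mf.
Qed.

Definition rV_cons {R : realType} {n : nat} (p : measurableTypeR R * 'rV[R]_n)
  : 'rV[R]_n.+1 := \row_(i < n.+1) oapp (p.2 ord0) p.1 (unlift ord0 i).

Definition rV_uncons {R : realType} {n : nat} (x : 'rV[R]_n.+1)
  : measurableTypeR R * 'rV[R]_n :=
  (x ord0 ord0, \row_(i < n) x ord0 (lift ord0 i)).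

Lemma rV_consK {R : realType} {n : nat} :
  cancel (@rV_cons R n) (@rV_uncons R n).
Proof.
move=> [a y]; rewrite /rV_uncons mxE unlift_none /=; congr pair.
by apply/rowP => i; rewrite !mxE liftK.
Qed.

Lemma rV_unconsK {R : realType} {n : nat} :
  cancel (@rV_uncons R n) (@rV_cons R n).
Proof.
by move=> x; apply/rowP => i; rewrite mxE; case: unliftP => [j|] -> /=;
  rewrite ?mxE.
Qed.

Lemma measurable_rV_cons {R : realType} {n : nat} :
  measurable_fun setT (@rV_cons R n).
Proof.
apply: measurable_fun_rVP => i; under eq_fun do rewrite mxE.
case: (unliftP ord0 i) => [j|] _ /=; last exact: measurable_fst.
exact: (measurableT_comp (measurable_coor j) measurable_snd).
Qed.

Lemma measurable_rV_uncons {R : realType} {n : nat} :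
  measurable_fun setT (@rV_uncons R n).
Proof.
apply: measurable_fun_pair; first exact: measurable_coor.
apply: measurable_fun_rVP => i; under eq_fun do rewrite mxE.
exact: measurable_coor.
Qed.

Section lebesgue_step.
Variables (R : realType) (n : nat).
Variable m : {sigma_finite_measure set 'rV[R]_n -> \bar R}.

Definition lebesgue_step : set 'rV[R]_n.+1 -> \bar R :=
  pushforward (@lebesgue_measure R \x m)%E rV_cons.

HB.instance Definition _ := Measure.copy lebesgue_step
  (measure_function_pushforward__canonical__measure_function_Measure
     (@lebesgue_measure R \x m)%E measurable_rV_cons).

Let lebesgue_step_sigma_finite : sigma_finite setT lebesgue_step.
Proof.
have /sigma_finiteP[F [TF ndF Foo]] := sigma_finiteT (@lebesgue_measure R).
have /sigma_finiteP[G [TG ndG Goo]] := sigma_finiteT m.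
exists (fun k => rV_uncons @^-1` (F k `*` G k)).
  rewrite -preimage_bigcup -[LHS](preimage_setT rV_uncons); congr preimage.
  rewrite -setXTT TF TG predeqE => -[x y]; split; last first.
    by move=> [k _ []/= ? ?]; split; exists k.
  move=> [/= [k _ Fx] [l _ Gy]]; exists (maxn k l) => //; split.
  - by move: x Fx; exact/subsetPset/ndF/leq_maxl.
  - by move: y Gy; exact/subsetPset/ndG/leq_maxr.
move=> k; have [mF Fk] := Foo k; have [mG Gk] := Goo k.
split.
  rewrite -[X in measurable X]setTI.
  by apply: measurable_rV_uncons => //; exact: measurableX.
rewrite /lebesgue_step /pushforward -comp_preimage.
rewrite (_ : _ \o _ = id) ?preimage_id; last exact/funext/rV_consK.
rewrite product_measure1E//; apply: lte_mul_pinfty => //.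
by rewrite ge0_fin_numE.
Qed.

HB.instance Definition _ :=
  Measure_isSigmaFinite.Build _ _ _ lebesgue_step lebesgue_step_sigma_finite.

End lebesgue_step.

(* The one-dimensional Lebesgue measure multiplied with itself n times; R^0 is a
   single point, of mass 1. *)
Fixpoint lebesgue_rV (R : realType) (n : nat)
  : {sigma_finite_measure set 'rV[R]_n -> \bar R} :=
  match n with
  | 0%N => @dirac _ 'rV[R]_0 0 R
  | n'.+1 => lebesgue_step (lebesgue_rV R n')
  end.

(* Real-valued: on bounded balls, where a continuous u is bounded, both the
   integral and the (positive) volume are finite.  For r <= 0 the ball is empty
   and the value is irrelevant. *)
Definition A2 {R : realType} {n : nat} (x : 'rV[R]_n) (r : R)
    (u : 'rV[R]_n -> R) : R :=
  Num.sqrt ((\int[lebesgue_rV R n]_(y in eball x r) (`|u y| ^+ 2)) /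
            fine (lebesgue_rV R n (eball x r))).

(* Main.v *)
Require Import Defs.
From mathcomp Require Import all_boot all_order all_algebra.
From mathcomp Require Import all_classical all_reals all_analysis.
From mathcomp Require Import measurable_realfun ring lra.
Import Order.TTheory GRing.Theory Num.Theory.
Import numFieldNormedType.Exports.
Local Open Scope classical_set_scope.
Local Open Scope ring_scope.

(** For a harmonic function [u], a point [z] and the weight
    [p y = max 0 (1 - |y|^2)], put

      [W a b = \int p y * u (z + a y) * u (z + b y) dy].

    The whole proof rests on the fact that [W a b] depends on the product
    [a * b] only.  To see it, let [a = rho e^s] and [b = rho e^-s] and
    differentiate in [s].  With [v y = u (z + a y)] and [w y = u (z + b y)] the
    integrand becomes [p * (y . (w grad v - v grad w))].  Since
    [y * p = - grad (p^2) / 4] and the field [w grad v - v grad w] is divergence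
    free, this is the divergence of a [C^1] field with compact support, and its
    integral vanishes ([green_weight], [pairing_expR]).  The Cauchy-Schwarz
    inequality [W a b ^ 2 <= W a a * W b b] then says that the energy
    [E r = W r r] satisfies [E (sqrt (a b)) ^ 2 <= E a * E b]
    ([energy_logconvex]): it is log-convex in [log r].  This is a three-balls
    inequality obtained without any expansion in spherical harmonics.

    It is used first around a point [x_m], with [s = |x_m|] and [r = r_m].
    Bisecting [k] times the logarithmic interval from [r] to [3 s] towards
    [3 s] gives a radius [rho] with [E rho ^ N <= E r * E (3 s) ^ (N - 1)],
    [N = 2 ^ k] ([energy_bisection]).  As soon as [N] exceeds
    [6 log (3 s / r)] one has [rho >= 5 s / 2], so that [E rho] controls the
    mean of [u^2] over the ball of centre [0] and radius [s]; minimality of [k]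
    leaves [N <= 100 log (2 s / r)], the constant of the theorem.  The ball
    of centre [x_m] and radius [3 s] lies in the one of centre [0] and radius
    [4 s], so [E (3 s)] is at most a constant times [phi (4 s) ^ 2], which is at
    most [e^(2 phi)].  Altogether, if the bracketed quantity of the hypothesis
    is at most [- K], the energy of centre [0] and radius [|x_m|] is at most a
    constant times [e^(- 2 K)] ([energy_decay]).

    It is used next around the origin.  There is [d > 0] such that
    [|x_m| >= d] infinitely often, and for such [m]
    [E d ^ 2 <= E (d^2 / |x_m|) * E |x_m|].  The first factor is bounded because
    [d^2 / |x_m| <= d], and the second one is arbitrarily small; hence
    [E d = 0].  Then [E t ^ 2 <= E d * E (t^2 / d) = 0] for all [t > 0], and
    [u] vanishes identically ([energy_eq0_all]). *)

(** * Measurability in R^n *)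

(** The sigma-algebra is generated by coordinates, so it contains the open boxes
    with rational centre and radius [1 / k]; an open set is the union of the
    countably many of these that it contains. *)
Lemma open_measurable_rV {R : realType} {n : nat} (U : set 'rV[R]_n) :
  open U -> measurable U.
Proof.
move=> oU.
pose box (p : 'rV[rat]_n * nat) : set 'rV[R]_n :=
  [set x | forall i, `|x ord0 i - ratr (p.1 ord0 i)| < p.2.+1%:R^-1].
pose F p : set 'rV[R]_n := if pselect (box p `<=` U) then box p else set0.
have -> : U = \bigcup_p F p.
  rewrite predeqE => x; split; last first.
    by move=> [p _]; rewrite /F; case: pselect => [h /h|].
  move=> Ux; have /nbhs_ballP[e /= e0 xeU] := open_nbhs_nbhs (conj oU Ux).
  have [k ke] : exists k : nat, k.+1%:R^-1 < e / 2.
    have e20 : 0 < e / 2 by rewrite divr_gt0.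
    exists (Num.trunc (e / 2)^-1); rewrite invf_plt ?posrE//.
    by have := truncnS_gt (e / 2)^-1.
  have /choice[q qP] : forall i, exists q : rat,
      `|x ord0 i - ratr q| < k.+1%:R^-1.
    move=> i.
    have [q] : exists q : rat,
        ratr q \in `]x ord0 i - k.+1%:R^-1, x ord0 i + k.+1%:R^-1[.
      by apply: rat_in_itvoo; rewrite ltrD2l gtrN// invr_gt0.
    by rewrite in_itv/= => h; exists q; rewrite ltr_distlC.
  exists (\row_i q i, k) => //; rewrite /F; case: pselect => [?|].
    by move=> i /=; rewrite mxE.
  case=> y yb; apply: xeU; split=> // i j; rewrite ord1 /ball/=.
  have := yb j; rewrite /= mxE => yq; have xq := qP j.
  have -> : x ord0 j - y ord0 j =
    (x ord0 j - ratr (q j)) - (y ord0 j - ratr (q j)) by ring.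
  apply: le_lt_trans (ler_normB _ _) _; rewrite (splitr e).
  by apply: ltrD; [apply: lt_trans xq ke|apply: lt_trans yq ke].
apply: countable_bigcupT_measurable => // p.
suff mb : measurable (box p).
  by rewrite /F; case: pselect => [?|?]; [exact: mb|exact: measurable0].
rewrite (_ : box p = \bigcap_(i in [set: 'I_n])
  ((fun x : 'rV[R]_n => x ord0 i : measurableTypeR R) @^-1`
    ball (ratr (p.1 ord0 i) : R) (p.2.+1%:R^-1))); last first.
  by rewrite predeqE => x; split=> [bx i _|bx i]; [|have := bx i I];
    rewrite /ball/= distrC.
apply: fin_bigcap_measurable => // i _.
rewrite -[X in measurable X]setTI; apply: measurable_coor => //.
by rewrite ball_itv; exact: measurable_itv.
Qed.

Lemma continuous_measurable_rV {R : realType} {n : nat} (f : 'rV[R]_n -> R) :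
  continuous f -> measurable_fun setT f.
Proof.
move=> /continuousP cf; apply: (measurability _ (RGenOpens.measurableE R)).
move=> _ [_ [a [b ->] <-]]; rewrite setTI.
by apply: open_measurable_rV; exact/cf/interval_open.
Qed.

(** * Iterated integrals and affine changes of variables *)

Definition cube {R : realType} (n : nat) (a : R) : set 'rV[R]_n :=
  [set x | forall i, `|x ord0 i| <= a].
Arguments cube {R} n a : simpl never.

Lemma measurable_cube {R : realType} {n : nat} (a : R) : measurable (cube n a).
Proof.
rewrite (_ : cube n a = \bigcap_(i in [set: 'I_n])
  ((fun x : 'rV[R]_n => x ord0 i : measurableTypeR R) @^-1` `[- a, a]%classic)).
  apply: fin_bigcap_measurable => // i _.
  by rewrite -[X in measurable X]setTI; apply: measurable_coor.
rewrite predeqE => x; split=> [h i _|h i]; [|have := h i I];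
  by rewrite /= in_itv/= -ler_norml//; exact: h.
Qed.

(** Cubes, unlike Euclidean balls, are products, so their measure is computed by
    induction on the dimension; it bounds the measure of balls from both sides. *)
Lemma lebesgue_rV_cube {R : realType} {n : nat} (a : R) : 0 <= a ->
  lebesgue_rV R n (cube n a) = ((2 * a) ^+ n)%:E.
Proof.
move=> a0; elim: n => [|n IHn].
  by rewrite /= diracE mem_set ?expr0// => -[].
rewrite /= /lebesgue_step /pushforward.
rewrite (_ : rV_cons @^-1` _ = `[- a, a]%classic `*` cube n a); last first.
  rewrite predeqE => -[t y]; split => [h|[/= + h] i]; first split => /=.
  - by have := h ord0; rewrite mxE unlift_none /= in_itv/= ler_norml.
  - by move=> i; have := h (lift ord0 i); rewrite mxE liftK.
  - by rewrite in_itv/= -ler_norml => ta; rewrite mxE; case: unliftP => [j|] _ /=.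
rewrite product_measure1E//; last exact: measurable_cube.
rewrite IHn [X in (X * _)%E]lebesgue_measure_itv/= lte_fin exprS EFinM.
case: ltP => [_|]; first by rewrite -EFinD; congr (_%:E * _)%E; ring.
move=> aNa; have -> : a = 0 by apply: le_anti; rewrite a0 andbT; lra.
by rewrite mulr0.
Qed.

Lemma tonelli_rV {R : realType} {n : nat} (f : 'rV[R]_n.+1 -> \bar R) :
  measurable_fun setT f -> (forall x, 0 <= f x)%E ->
  (\int[lebesgue_rV R n.+1]_x f x =
   \int[@lebesgue_measure R]_t \int[lebesgue_rV R n]_y f (rV_cons (t, y)))%E.
Proof.
move=> mf f0; rewrite /= /lebesgue_step.
rewrite ge0_integral_pushforward//=; last exact: measurable_rV_cons.
rewrite preimage_setT fubini_tonelli1//.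
exact: measurableT_comp mf measurable_rV_cons.
Qed.

Lemma integrable_cube {R : realType} {n : nat} (f : 'rV[R]_n -> R) (a M : R) :
  measurable_fun setT f -> (forall x, `|f x| <= M) ->
  (forall x, ~ cube n a x -> f x = 0) ->
  (lebesgue_rV R n).-integrable setT (EFin \o f).
Proof.
move=> mf fM f0; have := @measurable_cube R n `|a|; set K := cube n `|a| => mK.
have -> : EFin \o f = (EFin \o f) \_ K.
  apply/funext => x; rewrite patchE; case: ifPn => // /negP xK /=.
  rewrite f0// => h; apply: xK; rewrite inE => i.
  exact: le_trans (h i) (ler_norm _).
apply/(integrable_mkcond _ mK).
apply: measurable_bounded_integrable => //.
- by rewrite [X in (X < _)%E]lebesgue_rV_cube// ltry.
- exact: measurable_funTS.
- exists M; split; first exact: num_real.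
  by move=> B MB x _; apply: le_trans (fM x) (ltW MB).
Qed.

Lemma fubini_rV {R : realType} {n : nat} (f : 'rV[R]_n.+1 -> R) :
  measurable_fun setT f ->
  (lebesgue_rV R n.+1).-integrable setT (EFin \o f) ->
  (\int[lebesgue_rV R n.+1]_x (f x)%:E =
   \int[@lebesgue_measure R]_t \int[lebesgue_rV R n]_y (f (rV_cons (t, y)))%:E)%E /\
  (\int[lebesgue_rV R n.+1]_x (f x)%:E =
   \int[lebesgue_rV R n]_y \int[@lebesgue_measure R]_t (f (rV_cons (t, y)))%:E)%E.
Proof.
move=> mf intf.
have mg : measurable_fun setT (EFin \o f) by exact/measurable_EFinP.
have intg : (@lebesgue_measure R \x lebesgue_rV R n)%E.-integrable setT
    ((EFin \o f) \o rV_cons).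
  apply/integrableP; split.
    exact: measurableT_comp mg measurable_rV_cons.
  case/integrableP : intf => _; rewrite /= /lebesgue_step.
  rewrite ge0_integral_pushforward//=; first exact: measurable_rV_cons.
  by apply/measurable_EFinP; exact: measurableT_comp.
have -> : (\int[lebesgue_rV R n.+1]_x (f x)%:E =
    \int[@lebesgue_measure R \x lebesgue_rV R n]_z ((EFin \o f) \o rV_cons) z)%E.
  exact: (integral_pushforward measurable_rV_cons mg intg measurableT).
by split; [rewrite -integral12_prod_meas1|rewrite -integral21_prod_meas1].
Qed.

Section affine_change.
Context {R : realType}.
Variables (c a : R).
Hypothesis a0 : 0 < a.

Let T (t : measurableTypeR R) : measurableTypeR R := c + a * t.

Let mT : measurable_fun setT T.
Proof.
apply: continuous_measurable_fun => x.
apply: cvgD; [exact: cvg_cst|]; apply: cvgMr; exact: cvg_id.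
Qed.

Lemma lebesgue_measure_affine (A : set (measurableTypeR R)) : measurable A ->
  (lebesgue_measure A = a%:E * lebesgue_measure (T @^-1` A))%E.
Proof.
move=> mA.
pose m : {measure set (measurableTypeR R) -> \bar R} :=
  mscale (NngNum (ltW a0))
    (measure_function_pushforward__canonical__measure_function_Measure
      (@lebesgue_measure R) mT).
rewrite -[RHS]/(m A); apply: lebesgue_measure_unique => //.
move=> _ [[x y]] _ <-; have TE : T @^-1` `]x, y]%classic = `](x - c) / a, (y - c) / a]%classic.
  rewrite predeqE => t; rewrite /= !in_itv/= /T.
  by rewrite ltr_pdivrMr// ler_pdivlMr// ltrBlDl lerBrDl mulrC.
rewrite -[RHS]/(a%:E * lebesgue_measure (T @^-1` `]x, y]%classic))%E TE.
rewrite !lebesgue_measure_itv/= !lte_fin ltr_pM2r ?invr_gt0// ltrD2r.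
case: ifP => _; last by rewrite mule0.
by rewrite -!EFinD -EFinM; congr EFin; field; rewrite gt_eqF.
Qed.

Lemma ge0_integral_affine (g : R -> \bar R) :
  measurable_fun (setT : set (measurableTypeR R)) g -> (forall t, 0 <= g t)%E ->
  (\int[@lebesgue_measure R]_t g t =
   a%:E * \int[@lebesgue_measure R]_t g (c + a * t)%R)%E.
Proof.
move=> mg g0.
pose m : {measure set (measurableTypeR R) -> \bar R} :=
  mscale (NngNum (ltW a0))
    (measure_function_pushforward__canonical__measure_function_Measure
      (@lebesgue_measure R) mT).
rewrite (@eq_measure_integral _ _ _ setT m); last first.
  by move=> A mA _; exact: lebesgue_measure_affine.
rewrite ge0_integral_mscale//; congr (_ * _)%E.
exact: (ge0_integral_pushforward mT).
Qed.
End affine_change.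

Lemma measurable_affine_rV {R : realType} {n : nat} (c : 'rV[R]_n) (a : R) :
  measurable_fun setT (fun x : 'rV[R]_n => c + a *: x).
Proof.
apply: measurable_fun_rVP => i; under eq_fun do rewrite !mxE.
by apply: measurable_funD => //; apply: measurable_funM => //; exact: measurable_coor.
Qed.

(** The dimension is peeled off one coordinate at a time: the outer integral is
    changed by the one-dimensional formula, the inner one by induction. *)
Lemma ge0_integral_affine_rV {R : realType} {n : nat} (f : 'rV[R]_n -> \bar R)
    (c : 'rV[R]_n) (a : R) : 0 < a ->
  measurable_fun setT f -> (forall x, 0 <= f x)%E ->
  (\int[lebesgue_rV R n]_x f x =
   (a ^+ n)%:E * \int[lebesgue_rV R n]_x f (c + a *: x)%R)%E.
Proof.
move=> a0; elim: n f c => [|n IHn] f c mf f0.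
  rewrite expr0 mul1e; apply: eq_integral => x _; congr f.
  by apply/rowP => -[].
have mfc t : measurable_fun setT (fun y => f (rV_cons (t, y))).
  apply: (measurableT_comp mf); apply: (measurableT_comp measurable_rV_cons).
  exact: measurable_pair1.
have mfa := measurableT_comp mf (measurable_affine_rV c a).
rewrite tonelli_rV// (tonelli_rV _ mfa)//=.
pose G t := (\int[lebesgue_rV R n]_y f (rV_cons (t, y)))%E.
have mG : measurable_fun (setT : set (measurableTypeR R)) G.
  apply: (@measurable_fun_fubini_tonelli_F _ _ _ _ _ (lebesgue_rV R n) (f \o rV_cons)).
    exact: (measurableT_comp mf measurable_rV_cons).
  by move=> z; exact: f0.
have G0 t : (0 <= G t)%E by exact: integral_ge0.
rewrite (ge0_integral_affine (c ord0 ord0) _ a0 _ mG G0) exprS EFinM -muleA.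
congr (_ * _)%E; rewrite -ge0_integralZl//.
- apply: eq_integral => t _; rewrite /G.
  rewrite (IHn _ (\row_i c ord0 (lift ord0 i)))//; congr (_ * _)%E.
  apply: eq_integral => y _; congr f; apply/rowP => i; rewrite !mxE.
  by case: unliftP => [j|] -> /=; rewrite ?mxE.
- apply: (@measurable_fun_fubini_tonelli_F _ _ _ _ _ (lebesgue_rV R n)
    (f \o (fun x => c + a *: x) \o rV_cons)).
    exact: (measurableT_comp mfa measurable_rV_cons).
  by move=> z; exact: f0.
- by move=> t _; exact: integral_ge0.
- by rewrite lee_fin exprn_ge0// ltW.
Qed.

(** * Continuity, compactness and the Euclidean norm *)

(** The common source of the two Cauchy-Schwarz inequalities below, in R^n and
    under the integral sign. *)
Lemma discriminant_le {R : realFieldType} (A B C : R) :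
  (forall s t, 0 <= s ^+ 2 * A + 2 * s * t * B + t ^+ 2 * C) ->
  B ^+ 2 <= A * C.
Proof.
move=> q.
have A0 : 0 <= A by have := q 1 0; rewrite expr1n expr0n/= !mul1r !mulr0 !mul0r !addr0.
have C0 : 0 <= C by have := q 0 1; rewrite expr1n expr0n/= !mul1r !mulr0 !mul0r !add0r.
have [Cp|] := ltP 0 C.
  have := q C (- B).
  have -> : C ^+ 2 * A + 2 * C * (- B) * B + (- B) ^+ 2 * C = C * (A * C - B ^+ 2) by ring.
  by rewrite pmulr_rge0// subr_ge0.
move=> Cn; have -> : C = 0 by apply: le_anti; rewrite Cn C0.
rewrite mulr0; have [->|Bn0] := eqVneq B 0; first by rewrite expr0n.
(* For [C = 0] the form is affine in [t]; this [t] would make it [- A - 2]. *)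
have := q 1 (- (A + 1) / B).
have -> : 1 ^+ 2 * A + 2 * 1 * (- (A + 1) / B) * B + (- (A + 1) / B) ^+ 2 * C =
    - (A + 2) + (- (A + 1) / B) ^+ 2 * C by field.
have -> : C = 0 by apply: le_anti; rewrite Cn C0.
by rewrite mulr0 addr0 => h; exfalso; lra.
Qed.

Lemma continuous_affine {R : numFieldType} {V : normedModType R} (c : V) (a : R) :
  continuous (fun y : V => c + a *: y).
Proof.
move=> y; apply: cvgD; first exact: cvg_cst.
by apply: cvgZl_tmp; exact: cvg_id.
Qed.

Section continuous_real.
Context {R : realType} {T : topologicalType}.
Implicit Types f g : T -> R.

Lemma continuous_addR f g :
  continuous f -> continuous g -> continuous (fun x => f x + g x).
Proof. by move=> cf cg x; exact: cvgD (cf x) (cg x). Qed.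

Lemma continuous_subR f g :
  continuous f -> continuous g -> continuous (fun x => f x - g x).
Proof. by move=> cf cg x; exact: cvgB (cf x) (cg x). Qed.

Lemma continuous_mulR f g :
  continuous f -> continuous g -> continuous (fun x => f x * g x).
Proof. by move=> cf cg x; exact: cvgM (cf x) (cg x). Qed.
End continuous_real.

Lemma continuous_sumR {R : realType} {T : topologicalType} {I : Type}
    (r : seq I) (F : I -> T -> R) :
  (forall i, continuous (F i)) -> continuous (fun x => \sum_(i <- r) F i x).
Proof.
move=> cF; elim: r => [|i r IHr].
  by under eq_fun do rewrite big_nil; exact: cst_continuous.
under eq_fun do rewrite big_cons.
by move=> x; apply: cvgD; [exact: cF|exact: IHr].
Qed.

Section enorm.
Context {R : realType} {n : nat}.
Implicit Types x y : 'rV[R]_n.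

Definition sqnorm x : R := \sum_(i < n) x ord0 i ^+ 2.

Lemma sqnorm_ge0 x : 0 <= sqnorm x.
Proof. by apply: sumr_ge0 => i _; exact: sqr_ge0. Qed.

Lemma enorm_ge0 x : 0 <= enorm x. Proof. exact: sqrtr_ge0. Qed.

Lemma sqr_enorm x : enorm x ^+ 2 = sqnorm x.
Proof. by rewrite sqr_sqrtr// sqnorm_ge0. Qed.

Lemma sqnormZ (a : R) x : sqnorm (a *: x) = a ^+ 2 * sqnorm x.
Proof. by rewrite /sqnorm mulr_sumr; apply: eq_bigr => i _; rewrite mxE exprMn. Qed.

Lemma enormZ (a : R) x : 0 <= a -> enorm (a *: x) = a * enorm x.
Proof.
move=> a0; rewrite /enorm -/(sqnorm _) sqnormZ sqrtrM ?sqr_ge0//.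
by rewrite sqrtr_sqr ger0_norm.
Qed.

Lemma enormN x : enorm (- x) = enorm x.
Proof. by rewrite /enorm; under eq_bigr do rewrite mxE sqrrN. Qed.

Lemma coord_le_enorm x i : `|x ord0 i| <= enorm x.
Proof.
rewrite -(@ler_pXn2r _ 2%N) ?nnegrE ?enorm_ge0//.
rewrite real_normK ?num_real// sqr_enorm /sqnorm (bigD1 i)//= lerDl.
by apply: sumr_ge0 => j _; exact: sqr_ge0.
Qed.

Lemma enormD x y : enorm (x + y) <= enorm x + enorm y.
Proof.
rewrite -(@ler_pXn2r _ 2%N) ?nnegrE ?enorm_ge0//; last first.
  by rewrite addr_ge0 ?enorm_ge0.
pose D := \sum_(i < n) x ord0 i * y ord0 i.
have E (s t : R) : sqnorm (s *: x + t *: y) =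
    s ^+ 2 * sqnorm x + 2 * s * t * D + t ^+ 2 * sqnorm y.
  rewrite /sqnorm /D !mulr_sumr -!big_split/=; apply: eq_bigr => i _.
  by rewrite !mxE; ring.
have DB : D <= enorm x * enorm y.
  have : D ^+ 2 <= (enorm x * enorm y) ^+ 2.
    rewrite exprMn !sqr_enorm; apply: discriminant_le => s t.
    by rewrite -E sqnorm_ge0.
  rewrite -[leLHS]real_normK ?num_real// ler_pXn2r ?nnegrE ?mulr_ge0 ?enorm_ge0//.
  exact/le_trans/ler_norm.
rewrite sqr_enorm -[x]scale1r -[y]scale1r E !scale1r -!sqr_enorm; nra.
Qed.

Lemma enorm_lt x (r : R) : 0 < r -> (enorm x < r) = (sqnorm x < r ^+ 2).
Proof.
by move=> r0; rewrite -sqr_enorm ltr_pXn2r// nnegrE ?enorm_ge0// ltW.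
Qed.

Lemma continuous_coord (i : 'I_n) : continuous (fun x : 'rV[R]_n => x ord0 i).
Proof. exact: coord_continuous. Qed.

Lemma continuous_sqnorm : continuous sqnorm.
Proof.
apply: continuous_sumR => i x.
apply: (@continuous_comp _ _ _ (fun y : 'rV[R]_n => y ord0 i)
  (fun t => t ^+ 2)); [exact: continuous_coord|exact: exprn_continuous].
Qed.

Lemma continuous_enorm : continuous (@enorm R n).
Proof.
move=> x; apply: (continuous_comp _ (@sqrt_continuous R _)).
exact: continuous_sqnorm.
Qed.

Lemma eball_open x (r : R) : open (eball x r).
Proof.
rewrite (_ : eball x r = (fun y => enorm (y - x)) @^-1` [set t | t < r])//.
apply: open_comp; last exact: open_lt.
move=> y _; apply: continuous_comp; last exact: continuous_enorm.
have := @continuous_affine _ 'rV[R]_n (- x) 1 y.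
rewrite (_ : (fun y => _) = +%R^~ (- x))//.
by apply/funext => z; rewrite scale1r addrC.
Qed.

Lemma measurable_eball x (r : R) : measurable (eball x r).
Proof. by apply: open_measurable_rV; exact: eball_open. Qed.

Lemma bounded_on_cube (f : 'rV[R]_n -> R) (a : R) : continuous f ->
  exists2 M : R, 0 <= M & forall x, cube n a x -> `|f x| <= M.
Proof.
move=> cf.
have ck : compact (cube n a).
  rewrite (_ : cube n a = [set v : 'rV[R]_n |
    forall i, `[- a, a]%classic (v ord0 i)]).
    exact: (@rV_compact _ _ (fun=> `[- a, a]%classic) (fun i => @segment_compact R (- a) a)).
  by rewrite predeqE => x; split => h i; have := h i; rewrite /= in_itv/= -ler_norml.
have [[z Kz]|K0] := pselect (cube n a !=set0); last first.
  by exists 0 => // x Kx; exfalso; apply: K0; exists x.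
have cnf : continuous (fun x => `|f x|).
  by move=> x; apply: (continuous_comp (cf x)); exact: norm_continuous.
have [c _ cM] := compact_EVT_max (ex_intro _ z Kz) ck
  (continuous_subspaceT cnf).
by exists `|f c| => // x Kx; apply: cM; rewrite inE.
Qed.

Definition bounded_support (f : 'rV[R]_n -> R) :=
  exists a, forall x, ~ cube n a x -> f x = 0.

Lemma integrable_continuous (f : 'rV[R]_n -> R) :
  continuous f -> bounded_support f ->
  (lebesgue_rV R n).-integrable setT (EFin \o f).
Proof.
move=> cf [a f0]; have [M M0 fM] := bounded_on_cube f a cf.
apply: (@integrable_cube _ _ _ a M) => //; first exact: continuous_measurable_rV.
by move=> x; have [/fM//|/f0 ->] := pselect (cube n a x); rewrite normr0.
Qed.

Lemma bounded_supportM (f g : 'rV[R]_n -> R) :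
  bounded_support f -> bounded_support (fun x => f x * g x).
Proof. by move=> [a f0]; exists a => x /f0 ->; rewrite mul0r. Qed.

End enorm.

(** * Differentiation and integration by parts *)

Lemma integral_derive1_0 {R : realType} (g dg : R -> R) (a : R) :
  (forall t : R, is_derive t (1 : R) g (dg t)) -> continuous dg ->
  (forall t, a < `|t| -> g t = 0) ->
  (\int[@lebesgue_measure R]_t (dg t)%:E = 0)%E.
Proof.
move=> dgP cdg g0.
wlog a0 : a g0 / 0 <= a.
  move=> h; apply: (h `|a|) => // t ta; apply: g0; apply: le_lt_trans ta.
  exact: ler_norm.
have dg0 (t : R) : a < `|t| -> dg t = 0.
  move=> ta; suff h : is_derive t (1 : R) g 0.
    by rewrite -(@derive_val _ _ _ _ _ _ _ (dgP t)) (@derive_val _ _ _ _ _ _ _ h).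
  apply: near_eq_is_derive (is_derive_cst (0 : R) t (1 : R)).
  have : \forall s \near t, a < `|s|.
    exact: (cvgr_gt _ (@norm_continuous _ _ t) _ ta).
  by apply: filterS => s /g0 ->.
(* One step beyond the support, so that [g] vanishes at both end points. *)
pose b := a + 1.
have -> : (\int[@lebesgue_measure R]_t (dg t)%:E =
    \int[@lebesgue_measure R]_(t in `[(- b)%R, b]) (dg t)%:E)%E.
  rewrite [RHS]integral_mkcond; apply: eq_integral => t _.
  rewrite patchE; case: ifPn => //; rewrite notin_setE/= in_itv/= => /negP.
  rewrite -ler_norml -ltNge => tb; rewrite dg0//.
  by apply: lt_trans tb; rewrite /b ltrDl.
have cg : continuous g.
  move=> t; apply: differentiable_continuous; by apply/derivable1_diffP; case: (dgP t).
have b0 : 0 < b by rewrite /b ltr_wpDl.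
rewrite (@continuous_FTC2 _ dg g).
- by rewrite !g0 ?subee// ?normrN gtr0_norm// /b ltrDl.
- by rewrite gtrN.
- exact: continuous_subspaceT.
- split.
  + by move=> t _; case: (dgP t).
  + by apply: cvg_at_right_filter; exact: cg.
  + by apply: cvg_at_left_filter; exact: cg.
- by move=> t _; rewrite derive1E; have /@derive_val -> := dgP t.
Qed.

Lemma continuous_compR {T U V : topologicalType} (L : T -> U) (f : U -> V) :
  continuous L -> continuous f -> continuous (fun x => f (L x)).
Proof. by move=> cL cf x; apply: continuous_comp; [exact: cL|exact: cf]. Qed.

(** An affine change of variables carries a line in direction [v] to a line in
    direction [w], so both difference quotients are the same function.  This
    one statement serves for dilations, for slices and for curves. *)
Lemma is_derive_line {R : realType} {V W : normedModType R} (f : W -> R)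
    (L : V -> W) (x v : V) (w : W) (d : R) :
  (forall h : R, L (h *: v + x) = h *: w + L x) ->
  is_derive (L x) w f d <-> is_derive x v (f \o L) d.
Proof.
move=> LE.
have E : (fun h : R => h^-1 *: ((f \o shift (L x)) (h *: w) - f (L x))) =
    (fun h => h^-1 *: (((f \o L) \o shift x) (h *: v) - (f \o L) x)).
  by apply/funext => h /=; rewrite LE.
by split=> -[]; rewrite /derivable /derive ?E -?E => ? ?; split;
  rewrite /derivable /derive ?E -?E.
Qed.

Lemma is_derive_lineR {R : realType} {V : normedModType R} (f : V -> R)
    (x v : V) (d : R) :
  is_derive x v f d <-> is_derive (0 : R) (1 : R) (fun h : R => f (x + h *: v)) d.
Proof.
have := @is_derive_line R R V f (fun h => x + h *: v) 0 1 v d.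
rewrite scale0r addr0; apply => h.
by rewrite addr0 [h *: _]mulr1 addrC.
Qed.

Lemma is_derive_scale_direction {R : realType} {V : normedModType R} (f : V -> R)
    (x v : V) (a d : R) :
  is_derive x v f d -> is_derive x (a *: v) f (a * d).
Proof.
move=> /is_derive_lineR fd; apply/is_derive_lineR.
have -> : (fun h : R => f (x + h *: (a *: v))) =
    (fun h => f (x + h *: v)) \o (fun h => a * h).
  by apply/funext => h /=; rewrite scalerA mulrC.
rewrite mulrC; apply: is_derive1_comp; first by rewrite mulr0.
have := @is_deriveZ R R R id a 0 1 1 (is_derive_id _ _).
by rewrite [a *: _]mulr1.
Qed.

Lemma mean_value {R : realType} (g dg : R -> R) (h : R) :
  (forall t : R, is_derive t (1 : R) g (dg t)) ->
  exists2 c, `|c| <= `|h| & g h - g 0 = dg c * h.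
Proof.
move=> gd.
have cg : continuous g.
  move=> t; apply: differentiable_continuous; apply/derivable1_diffP.
  by case: (gd t).
have [h0|h0] := leP 0 h.
  have [c] := MVT_segment h0 (fun t _ => gd t) (continuous_subspaceT cg).
  rewrite in_itv/= subr0 => /andP[c0 ch] E; exists c => //.
  by rewrite !ger0_norm.
have [c] := MVT_segment (ltW h0) (fun t _ => gd t) (continuous_subspaceT cg).
rewrite in_itv/= => /andP[hc c0] E; exists c.
  by rewrite !ler0_norm ?lerN2// ltW.
by rewrite -[LHS]opprB E sub0r mulrN opprK.
Qed.

(** The increment along [h (v + w)] is the increment along [h w] followed by one
    along [h v]; the mean value theorem turns the latter into [h * dv] at a
    nearby point.  Iterated over the coordinates, this is how continuous partial
    derivatives give the derivative in every direction. *)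
Lemma is_derive_add_direction {R : realType} {V : normedModType R} (f dv : V -> R)
    (v w : V) (x : V) (dw : R) :
  (forall y, is_derive y v f (dv y)) -> {for x, continuous dv} ->
  is_derive x w f dw -> is_derive x (v + w) f (dv x + dw).
Proof.
move=> fv cdv /is_derive_lineR fw; apply/is_derive_lineR.
pose psi (h : R) := f (x + h *: w + h *: v) - f (x + h *: w).
have -> : (fun h : R => f (x + h *: (v + w))) =
    psi + (fun h => f (x + h *: w)).
  apply/funext => h; rewrite /psi /= !fctE subrK scalerDr; congr f.
  by rewrite -addrA; congr (_ + _); rewrite addrC.
have psi_near : h^-1 *: ((psi \o shift 0) (h *: (1 : R)) - psi 0) @[h --> 0^'] --> dv x.
  apply/cvgrPdist_le => e e0.
  have /cvgrPdist_le/(_ e e0)/nbhs_ballP[r /= r0 xr] := cdv.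
  pose N := `|w| + `|v| + 1.
  have N0 : 0 < N by rewrite ltr_wpDl// addr_ge0.
  near=> h.
  have hn0 : h != 0 by near: h; exact: nbhs_dnbhs_neq.
  have hr : `|h| < r / N by near: h; apply: dnbhs0_lt; rewrite divr_gt0.
  rewrite /= addr0 [h *: 1]mulr1.
  have -> : psi 0 = 0 by rewrite /psi !scale0r !addr0 subrr.
  have [|c ch] := @mean_value R (fun t => f (x + h *: w + t *: v))
    (fun t => dv (x + h *: w + t *: v)) h.
    move=> t; have := @is_derive_line R R V f (fun t => x + h *: w + t *: v) t 1 v
      (dv (x + h *: w + t *: v)).
    case=> [s|E _]; last exact: E.
    by rewrite [s *: _]mulr1 scalerDl addrCA.
  rewrite scale0r addr0 -/(psi h) subr0 => ->.
  rewrite [_ *: _]mulrC mulfK//; apply: xr; rewrite -ball_normE/=.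
  rewrite -!addrA opprD addNKr normrN.
  apply: le_lt_trans (ler_normD _ _) _; rewrite !normrZ.
  apply: (@le_lt_trans _ _ (`|h| * N)); last by rewrite -ltr_pdivlMr.
  rewrite /N mulrDr mulr1 mulrDr.
  have := ler_wpM2r (normr_ge0 v) ch; have := normr_ge0 h; set A := _ * `|v|.
  by set B := `|c| * _ => h0 BA; rewrite -addrA lerD2l ler_wpDr.
apply: (@is_deriveD _ _ _ psi).
by apply: DeriveDef; [apply/cvg_ex; exists (dv x)|exact: cvg_lim psi_near].
Unshelve. all: by end_near. Qed.

Section gradient.
Context {R : realType} {n : nat}.
Variable f : 'rV[R]_n -> R.
Hypothesis pf : forall i, has_partial i f /\ continuous (partial i f).

Lemma is_derive_gradient (x y : 'rV[R]_n) :
  is_derive x y f (\sum_(i < n) y ord0 i * partial i f x).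
Proof.
rewrite [y in is_derive _ y]row_sum_delta.
elim: (index_enum _) x => [|i s IHs] x.
  by rewrite !big_nil; exact: is_derive0.
rewrite !big_cons; apply: (@is_derive_add_direction R 'rV[R]_n f
  (fun x => y ord0 i * partial i f x)).
- move=> z; apply: is_derive_scale_direction; have [fi _] := pf i.
  exact: DeriveDef (fi z) erefl.
- have [_ c] := pf i; apply: (@continuous_mulR _ _ (fun=> y ord0 i)) => //.
  by move=> z; exact: cst_continuous.
Qed.

End gradient.

Lemma continuous_rV {R : realType} {T : topologicalType} {n : nat}
    (f : T -> 'rV[R]_n) :
  (forall i, continuous (fun t => f t ord0 i)) -> continuous f.
Proof.
move=> cf t; apply/cvg_ballP => e e0.
have : \forall s \near t, forall i, ball (f t ord0 i) e (f s ord0 i).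
  by apply: filter_forall => i; exact: (cvg_ball (cf i t)).
by apply: filterS => s h; split=> // i j; rewrite ord1; exact: h.
Qed.

Lemma delta_mx_cons {R : realType} {n : nat} (j : 'I_n) (t : R) (y : 'rV[R]_n) (h : R) :
  rV_cons (t, h *: delta_mx ord0 j + y) =
  h *: delta_mx ord0 (lift ord0 j) + rV_cons (t, y).
Proof.
apply/rowP => k; rewrite !mxE; case: unliftP => [l|] ->.
  by rewrite /= !mxE (inj_eq lift_inj).
by rewrite (negbTE (neq_lift _ _)) andbF mulr0 add0r.
Qed.

(** Fubini's theorem makes the [i]-th coordinate the inner variable, and the
    integral of a derivative with compact support over a line is zero. *)
Lemma integral_partial_0 {R : realType} {n : nat} (i : 'I_n)
    (g dg : 'rV[R]_n -> R) :
  (forall x, is_derive x (delta_mx ord0 i : 'rV[R]_n) g (dg x)) ->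
  continuous dg -> bounded_support g -> bounded_support dg ->
  (\int[lebesgue_rV R n]_x (dg x)%:E = 0)%E.
Proof.
elim: n i g dg => [[]//|n IHn] i g dg dgP cdg [a g0] [b dg0].
have [F1 F2] := fubini_rV _ (continuous_measurable_rV _ cdg)
  (integrable_continuous _ cdg (ex_intro _ b dg0)).
have cube_fst (t c : R) y : ~ `|t| <= c -> ~ cube n.+1 c (rV_cons (t, y)).
  by move=> tc h; apply: tc; have := h ord0; rewrite mxE unlift_none.
have cube_snd (t c : R) y : ~ cube n c y -> ~ cube n.+1 c (rV_cons (t, y)).
  by move=> yc h; apply: yc => j; have := h (lift ord0 j); rewrite mxE liftK.
have [j|] := unliftP ord0 i => ij; subst i.
  rewrite F1; apply: integral0_eq => t _.
  apply: (IHn j (fun y => g (rV_cons (t, y))) (fun y => dg (rV_cons (t, y)))).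
  - move=> y.
    have := @is_derive_line R _ _ g (fun y => rV_cons (t, y)) y
      (delta_mx ord0 j) (delta_mx ord0 (lift ord0 j)) (dg (rV_cons (t, y))).
    by case=> [s|E _]; [exact: delta_mx_cons|exact: E].
  - apply: continuous_compR cdg; apply: continuous_rV => k.
    under eq_fun do rewrite mxE; case: unliftP => [l|] _ /=.
      exact: continuous_coord.
    by move=> s; exact: cst_continuous.
  - by exists a => y ya; apply: g0; exact: cube_snd.
  - by exists b => y yb; apply: dg0; exact: cube_snd.
rewrite F2; apply: integral0_eq => y _.
apply: (@integral_derive1_0 R (fun t => g (rV_cons (t, y))) (fun t => dg (rV_cons (t, y))) a).
- move=> t.
  have := @is_derive_line R _ _ g (fun t : R => rV_cons (t, y)) t
    (1 : R) (delta_mx ord0 ord0) (dg (rV_cons (t, y))).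
  case=> [s|E _]; last exact: E.
  apply/rowP => k; rewrite !mxE /=; case: unliftP => [l|] -> /=.
    by rewrite mulr0 add0r.
  by rewrite [s *: _]mulr1 mulr1.
- apply: continuous_compR cdg; apply: continuous_rV => k.
  under eq_fun do rewrite mxE; case: unliftP => [l|] _ /=.
    by move=> s; exact: cst_continuous.
  by move=> s; exact: cvg_id.
- by move=> t; rewrite ltNge => /negP ta; apply: g0; exact: cube_fst.
Qed.

(** * Green's identity against the weight *)

Section weight.
Context {R : realType} {n : nat}.
Implicit Types x y : 'rV[R]_n.

(** The weight replaces the indicator of the unit ball: it has the radial
    gradient needed below, and its square is of class [C^1] on the whole space,
    which removes every boundary term. *)
Definition weight y : R := Num.max 0 (1 - sqnorm y).

Lemma weight_ge0 y : 0 <= weight y.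
Proof. by rewrite /weight le_max lexx. Qed.

Lemma weight_le1 y : weight y <= 1.
Proof. by rewrite /weight ge_max ler01 gerBl sqnorm_ge0. Qed.

Lemma continuous_weight : continuous weight.
Proof.
move=> y; apply: (@continuous_max _ _ (fun=> 0) (fun y => 1 - sqnorm y)).
  exact: cst_continuous.
apply: (@continuous_subR _ _ (fun=> 1) sqnorm); last exact: continuous_sqnorm.
by move=> z; exact: cst_continuous.
Qed.

Lemma weight_out_ball y : ~ eball 0 1 y -> weight y = 0.
Proof.
move=> y1; apply/max_idPl; rewrite subr_le0 leNgt; apply/negP => sy.
by apply: y1; rewrite /eball/= subr0 enorm_lt// expr1n.
Qed.

Lemma weight_out_cube y : ~ cube n 1 y -> weight y = 0.
Proof.
move=> y1; apply: weight_out_ball; rewrite /eball/= subr0 => sy.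
by apply: y1 => i; exact: le_trans (coord_le_enorm y i) (ltW sy).
Qed.

Lemma bounded_support_weight : bounded_support weight.
Proof. by exists 1 => y; exact: weight_out_cube. Qed.

(** The remainder of the first-order expansion is at most [h ^ 2] in absolute
    value whatever the signs of [t] and [t + h]; no case is special at the
    kink. *)
Lemma is_derive_sqr_pos (t : R) :
  is_derive t (1 : R) (fun t => Num.max 0 t ^+ 2) (2 * Num.max 0 t).
Proof.
pose q (t : R) : R := Num.max 0 t ^+ 2.
have qE h : `|q (t + h) - q t - 2 * Num.max 0 t * h| <= h ^+ 2.
  rewrite /q ler_norml; case: (leP 0 t) => t0; case: (leP 0 (t + h)) => th;
    apply/andP; split; nra.
have qlim : h^-1 *: ((q \o shift t) (h *: (1 : R)) - q t) @[h --> 0^'] -->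
    2 * Num.max 0 t.
  apply/cvgrPdist_le => e e0; near=> h.
  have hn0 : h != 0 by near: h; exact: nbhs_dnbhs_neq.
  have he : `|h| < e by near: h; exact: dnbhs0_lt.
  rewrite /= [h *: 1]mulr1 [_ *: _]mulrC distrC.
  rewrite (_ : _ - _ = (q (t + h) - q t - 2 * Num.max 0 t * h) / h); last first.
    by rewrite [h + t]addrC; field.
  rewrite normrM normfV ler_pdivrMr ?normr_gt0//.
  apply: le_trans (qE h) _; rewrite -real_normK ?num_real// expr2.
  by rewrite ler_wpM2r// ltW.
by apply: DeriveDef; [apply/cvg_ex; eexists; exact: qlim|exact: cvg_lim qlim].
Unshelve. all: by end_near. Qed.

Lemma is_derive_sqnorm y i :
  is_derive y (delta_mx ord0 i : 'rV[R]_n) sqnorm (2 * y ord0 i).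
Proof.
apply/is_derive_lineR.
have -> : (fun h : R => sqnorm (y + h *: delta_mx ord0 i)) =
    cst (sqnorm y) + ((2 * y ord0 i) \*: id + (id * id)).
  apply/funext => h /=; rewrite !fctE /sqnorm (bigD1 i)//= [in RHS](bigD1 i)//=.
  rewrite [X in _ + X](_ : _ = \sum_(j < n | j != i) y ord0 j ^+ 2); last first.
    by apply: eq_bigr => j ji; rewrite !mxE (negbTE ji) andbF mulr0 addr0.
  by rewrite !mxE !eqxx /= /GRing.scale/=; ring.
have d0 := is_derive_id (0 : R) (1 : R).
have /is_derive_eq := is_deriveD (is_derive_cst (sqnorm y) (0 : R) (1 : R))
  (is_deriveD (is_deriveZ (2 * y ord0 i) d0) (is_deriveM d0 d0)).
by apply; rewrite /GRing.scale/=; ring.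
Qed.

Lemma is_derive_sqr_weight y i : is_derive y (delta_mx ord0 i : 'rV[R]_n)
  (fun x => weight x ^+ 2) (- 4 * y ord0 i * weight y).
Proof.
apply/is_derive_lineR.
have /is_derive_lineR d := is_derive_sqnorm y i.
have := @is_derive1_comp R (fun t => Num.max 0 t ^+ 2)
  (fun h => 1 - sqnorm (y + h *: delta_mx ord0 i)) 0 (2 * weight y) (- (2 * y ord0 i)).
rewrite (_ : 2 * weight y * _ = - 4 * y ord0 i * weight y); last by ring.
apply; first by rewrite scale0r addr0; exact: is_derive_sqr_pos.
by have := is_deriveB (is_derive_cst (1 : R) (0 : R) (1 : R)) d; rewrite sub0r.
Qed.

End weight.

Section green.
Context {R : realType} {n : nat}.

Lemma Rintegral_sum0 (I : Type) (r : seq I) (F : I -> 'rV[R]_n -> R) :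
  (forall i, (lebesgue_rV R n).-integrable setT (EFin \o F i)) ->
  (forall i, \int[lebesgue_rV R n]_y F i y = 0) ->
  \int[lebesgue_rV R n]_y (\sum_(i <- r) F i y) = 0.
Proof.
move=> Fi F0.
suff [] : \int[lebesgue_rV R n]_y (\sum_(i <- r) F i y) = 0 /\
  (lebesgue_rV R n).-integrable setT (EFin \o (fun y => \sum_(i <- r) F i y)) by [].
elim: r => [|i r [IH1 IH2]].
  under [X in Rintegral _ _ X]eq_fun do rewrite big_nil.
  rewrite (_ : EFin \o _ = cst 0%E); last by apply/funext => y /=; rewrite big_nil.
  by split; [rewrite Rintegral_cst// mul0r|exact: integrable0].
rewrite (_ : (fun y => \sum_(j <- i :: r) F j y) =
  (fun y => F i y + \sum_(j <- r) F j y)); last first.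
  by apply/funext => y; rewrite big_cons.
split; first by rewrite RintegralD// F0 IH1 addr0.
rewrite (_ : EFin \o _ = (EFin \o F i) \+ (EFin \o (fun y => (\sum_(j <- r) F j y)%R)))%E.
  exact: integrableD.
by apply/funext => y.
Qed.

(** The field [p^2 (w grad v - v grad w)] is of class [C^1] with compact support.
    Since [v] and [w] are harmonic its divergence is
    [- 4 p (y . (w grad v - v grad w))]. *)
Lemma green_weight (v w : 'rV[R]_n -> R) (v1 w1 v2 w2 : 'I_n -> 'rV[R]_n -> R) :
  continuous v -> continuous w ->
  (forall i, continuous (v1 i)) -> (forall i, continuous (w1 i)) ->
  (forall i, continuous (v2 i)) -> (forall i, continuous (w2 i)) ->
  (forall i y, is_derive y (delta_mx ord0 i : 'rV[R]_n) v (v1 i y)) ->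
  (forall i y, is_derive y (delta_mx ord0 i : 'rV[R]_n) w (w1 i y)) ->
  (forall i y, is_derive y (delta_mx ord0 i : 'rV[R]_n) (v1 i) (v2 i y)) ->
  (forall i y, is_derive y (delta_mx ord0 i : 'rV[R]_n) (w1 i) (w2 i y)) ->
  (forall y, \sum_i v2 i y = 0) -> (forall y, \sum_i w2 i y = 0) ->
  \int[lebesgue_rV R n]_y (weight y *
    \sum_i (y ord0 i * (w y * v1 i y - v y * w1 i y))) = 0.
Proof.
move=> cv cw cv1 cw1 cv2 cw2 dv dw dv1 dw1 hv hw.
pose V i y := w y * v1 i y - v y * w1 i y.
have cV i : continuous (V i).
  by apply: continuous_subR; apply: continuous_mulR.
have dV i y : is_derive y (delta_mx ord0 i : 'rV[R]_n) (V i)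
    (w y * v2 i y - v y * w2 i y).
  have /is_derive_eq := is_deriveB (is_deriveM (dw i y) (dv1 i y))
    (is_deriveM (dv i y) (dw1 i y)).
  by apply; rewrite /GRing.scale/=; ring.
pose g i y := weight y ^+ 2 * V i y.
pose dg i y := weight y * (- 4 * (y ord0 i * V i y) +
  weight y * (w y * v2 i y - v y * w2 i y)).
have dgP i y : is_derive y (delta_mx ord0 i : 'rV[R]_n) (g i) (dg i y).
  have /is_derive_eq := is_deriveM (is_derive_sqr_weight y i) (dV i y).
  by apply; rewrite /dg /V /GRing.scale/=; ring.
have cdg i : continuous (dg i).
  apply: continuous_mulR; first exact: continuous_weight.
  apply: continuous_addR; apply: continuous_mulR.
  - by move=> z; exact: cst_continuous.
  - by apply: continuous_mulR => //; exact: continuous_coord.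
  - exact: continuous_weight.
  - by apply: continuous_subR; apply: continuous_mulR.
have sdg i : bounded_support (dg i) by apply: bounded_supportM; exact: bounded_support_weight.
have sg i : bounded_support (g i).
  do 2!apply: bounded_supportM; exact: bounded_support_weight.
have idg i := integrable_continuous _ (cdg i) (sdg i).
have dg0 i : \int[lebesgue_rV R n]_y dg i y = 0.
  by rewrite /Rintegral (integral_partial_0 i (g i)).
have E y : weight y * \sum_i (y ord0 i * V i y) = - 4^-1 * \sum_i dg i y.
  rewrite /dg -mulr_sumr big_split/= -!mulr_sumr sumrB -!mulr_sumr hv hw.
  by field.
under eq_Rintegral do rewrite E.
have ia : (lebesgue_rV R n).-integrable setT (EFin \o (fun y => \sum_i dg i y)).
  apply: integrable_continuous; first exact: (@continuous_sumR _ _ _ _ dg cdg).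
  have [a wa] := @bounded_support_weight R n; exists a => y /wa wy.
  by rewrite big1// => i _; rewrite /dg wy mul0r.
by rewrite RintegralZl// Rintegral_sum0// mulr0.
Qed.
End green.

Lemma norm_subMM_le {R : realDomainType} (a b c d M N : R) :
  `|a| <= M -> `|b| <= N -> `|c| <= M -> `|d| <= N ->
  `|a * b - c * d| <= M * N * 2.
Proof.
move=> aM bN cM dN; apply: le_trans (ler_normB _ _) _; rewrite !normrM mulr_natr.
by apply: lerD; apply: ler_pM.
Qed.

(** * The pairing of two dilations of a harmonic function *)

Section pairing.
Context {R : realType} {n : nat}.
Variable u : 'rV[R]_n -> R.
Hypothesis hu : harmonic_on_Rn u.
Variable z : 'rV[R]_n.

Definition pairing (a b : R) : R :=
  \int[lebesgue_rV R n]_y (weight y * (u (z + a *: y) * u (z + b *: y))).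

Let cu : continuous u. Proof. by case: hu => -[]. Qed.

Let pu i : has_partial i u /\ continuous (partial i u).
Proof. by case: hu => -[]. Qed.

Let ppu i : has_partial i (partial i u) /\ continuous (partial i (partial i u)).
Proof. by case: hu => -[_ _ h] _; exact: h. Qed.

Let caff a : continuous (fun y : 'rV[R]_n => z + a *: y).
Proof. exact: continuous_affine. Qed.

Lemma continuous_dilate (f : 'rV[R]_n -> R) (a : R) :
  continuous f -> continuous (fun y : 'rV[R]_n => f (z + a *: y)).
Proof.
move=> cf.
exact: (@continuous_compR _ _ _ (fun y : 'rV[R]_n => z + a *: y) f (caff a) cf).
Qed.

Lemma integrable_weight (f : 'rV[R]_n -> R) : continuous f ->
  (lebesgue_rV R n).-integrable setT (EFin \o (fun y => weight y * f y)).
Proof.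
move=> cf; apply: integrable_continuous.
  by apply: continuous_mulR => //; exact: continuous_weight.
by apply: bounded_supportM; exact: bounded_support_weight.
Qed.

Let is_derive_dilate (f : 'rV[R]_n -> R) (a : R) i (y : 'rV[R]_n) :
  derivable f (z + a *: y) (delta_mx ord0 i) ->
  is_derive y (delta_mx ord0 i : 'rV[R]_n) (fun x : 'rV[R]_n => f (z + a *: x))
    (a * partial i f (z + a *: y)).
Proof.
move=> df; pose e : 'rV[R]_n := delta_mx ord0 i.
have LE (h : R) : z + a *: (h *: e + y) = h *: (a *: e) + (z + a *: y).
  by rewrite scalerDr !scalerA [h * a]mulrC addrCA.
have [H _] := @is_derive_line R _ _ f (fun x : 'rV[R]_n => z + a *: x) y e
  (a *: e) (a * partial i f (z + a *: y)) LE.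
by apply: H; apply: is_derive_scale_direction; exact: DeriveDef df erefl.
Qed.

(* The radial derivative [y . grad u] at the point [z + a y]. *)
Let euler (a : R) (y : 'rV[R]_n) := \sum_i y ord0 i * partial i u (z + a *: y).

Let is_derive_radial (y : 'rV[R]_n) (c : R) :
  is_derive c (1 : R) (fun c : R => u (z + c *: y)) (euler c y).
Proof.
have LE (h : R) : z + (h *: (1 : R) + c) *: y = h *: y + (z + c *: y).
  by rewrite [h *: 1]mulr1 scalerDl addrCA.
have [H _] := @is_derive_line R _ _ u (fun c : R => z + c *: y) c (1 : R) y
  (euler c y) LE.
by apply: H; exact: is_derive_gradient.
Qed.

Lemma green_pairing (a b : R) :
  \int[lebesgue_rV R n]_y (weight y *
    (u (z + b *: y) * (a * euler a y) - u (z + a *: y) * (b * euler b y))) = 0.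
Proof.
pose v1 c i (y : 'rV[R]_n) := c * partial i u (z + c *: y).
pose v2 c i (y : 'rV[R]_n) := c * (c * partial i (partial i u) (z + c *: y)).
have cZ (c : R) (f : 'rV[R]_n -> R) : continuous f -> continuous (fun y => c * f y).
  by move=> cf; apply: continuous_mulR => // x; exact: cst_continuous.
have cv c : continuous (fun y : 'rV[R]_n => u (z + c *: y)) by exact: continuous_dilate.
have cv1 c i : continuous (v1 c i).
  by apply: cZ; apply: continuous_dilate; case: (pu i).
have cv2 c i : continuous (v2 c i).
  by do 2!apply: (cZ c); apply: continuous_dilate; case: (ppu i).
have dv c i y : is_derive y (delta_mx ord0 i : 'rV[R]_n)
    (fun y : 'rV[R]_n => u (z + c *: y)) (v1 c i y).
  by apply: is_derive_dilate; case: (pu i).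
have dv1 c i y : is_derive y (delta_mx ord0 i : 'rV[R]_n) (v1 c i) (v2 c i y).
  have [d _] := ppu i.
  by have := is_deriveZ c (is_derive_dilate _ c i y (d (z + c *: y))).
have lap c y : \sum_i v2 c i y = 0.
  have := proj2 hu (z + c *: y); rewrite /laplacian => E.
  by rewrite /v2 -!mulr_sumr E !mulr0.
rewrite -[RHS](green_weight _ _ _ _ _ _ (cv a) (cv b) (cv1 a) (cv1 b) (cv2 a) (cv2 b)
  (dv a) (dv b) (dv1 a) (dv1 b) (lap a) (lap b)).
apply: eq_Rintegral => y _; congr (_ * _).
rewrite /euler !mulr_sumr -sumrB; apply: eq_bigr => i _; rewrite /v1; ring.
Qed.

(** The derivative in [s] is the integral of [green_pairing], hence zero.
    Differentiation under the integral sign is dominated on [(t - 1, t + 1)] by a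
    multiple of the weight, because [u] and its gradient are bounded on the cube
    that contains all the points [z + c y] with [|c| <= |rho| e^(|t| + 1)] and [y]
    in the unit cube. *)
Lemma pairing_expR (rho s : R) :
  pairing (rho * expR s) (rho * expR (- s)) = pairing rho rho.
Proof.
pose f s (y : 'rV[R]_n) := weight y *
  (u (z + (rho * expR s) *: y) * u (z + (rho * expR (- s)) *: y)).
pose df s (y : 'rV[R]_n) := weight y *
  (u (z + (rho * expR (- s)) *: y) * ((rho * expR s) * euler (rho * expR s) y) -
   u (z + (rho * expR s) *: y) * ((rho * expR (- s)) * euler (rho * expR (- s)) y)).
have dfP y t : is_derive t (1 : R) (f ^~ y) (df t y).
  have d1 := @is_derive1_comp R _ (fun t => rho * expR t) t _ _
    (is_derive_radial y (rho * expR t)) (is_deriveZ rho (is_derive_expR t)).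
  have dN := @is_derive1_comp R expR -%R t _ _ (is_derive_expR (- t))
    (is_deriveN (is_derive_id t (1 : R))).
  have d2 := @is_derive1_comp R _ (fun t => rho * expR (- t)) t _ _
    (is_derive_radial y (rho * expR (- t))) (is_deriveZ rho dN).
  have /is_derive_eq := is_deriveZ (weight y) (is_deriveM d1 d2).
  apply; rewrite /df /GRing.scale/=.
  move: (euler (rho * expR t) y) (euler (rho * expR (- t)) y) => e1 e2.
  move: (u (z + (rho * expR t) *: y)) (u (z + (rho * expR (- t)) *: y)) => u1 u2.
  by move: (weight y) (expR t) (expR (- t)) => p E1 E2; ring.
have intf t : (lebesgue_rV R n).-integrable setT (EFin \o f t).
  by apply: integrable_weight; apply: continuous_mulR; exact: continuous_dilate.
pose F t := \int[lebesgue_rV R n]_y f t y.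
have FP t : is_derive t (1 : R) F 0.
  pose A := enorm z + `|rho| * expR (`|t| + 1).
  have [M0 M00 uM] := bounded_on_cube u A cu.
  have cG : continuous (fun x => \sum_i `|partial i u x|).
    apply: continuous_sumR => i x; have [_ c] := pu i.
    by apply: continuous_comp; [exact: c|exact: norm_continuous].
  have [M1 M10 duM] := bounded_on_cube _ A cG.
  pose K := `|rho| * expR (`|t| + 1) * M0 * M1 * 2.
  have It : `]t - 1, t + 1[%classic t by rewrite /= in_itv/= gtrBl ltrDl ltr01.
  have dfE x y : partial1of2 f x y = df x y.
    by rewrite partial1of2E; exact: (@derive_val _ _ _ _ _ _ _ (dfP y x)).
  have bnd c (y : 'rV[R]_n) : cube n 1 y -> `|c| <= `|rho| * expR (`|t| + 1) ->
      `|u (z + c *: y)| <= M0 /\ `|c * euler c y| <= `|rho| * expR (`|t| + 1) * M1.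
    move=> y1 cB.
    have zA : cube n A (z + c *: y).
      move=> i; rewrite !mxE; apply: le_trans (ler_normD _ _) _; apply: lerD.
        exact: coord_le_enorm.
      rewrite normrM; apply: le_trans cB; rewrite ler_piMr//; exact: y1.
    split; first exact: uM.
    rewrite normrM; apply: ler_pM => //.
    apply: le_trans (duM _ zA).
    rewrite [leRHS]ger0_norm ?sumr_ge0//.
    apply: le_trans (ler_norm_sum _ _ _) _; apply: ler_sum => i _.
    by rewrite normrM ler_piMl//; exact: y1.
  have dfK x y : x \in `]t - 1, t + 1[ -> `|df x y| <= K * weight y.
    rewrite in_itv/= => /andP[x1 x2].
    have xt : `|x| <= `|t| + 1.
      rewrite (_ : x = t + (x - t)); last by ring.
      apply: le_trans (ler_normD _ _) _; rewrite lerD2l ler_norml.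
      by apply/andP; split; lra.
    have cb (e : R) : `|e| <= `|t| + 1 ->
        `|rho * expR e| <= `|rho| * expR (`|t| + 1).
      move=> eb; rewrite normrM ler_wpM2l// ger0_norm ?expR_ge0// ler_expR.
      exact: le_trans (ler_norm _) eb.
    have [y1|y1] := pselect (cube n 1 y); last first.
      by rewrite /df weight_out_cube// mul0r mulr0 normr0.
    have [u1 e1] := bnd _ _ y1 (cb x xt).
    have [|u2 e2] := bnd _ _ y1 (cb (- x) _); first by rewrite normrN.
    rewrite /df normrM (ger0_norm (weight_ge0 _)) mulrC ler_wpM2r ?weight_ge0//.
    have -> : K = M0 * (`|rho| * expR (`|t| + 1) * M1) * 2 by rewrite /K; ring.
    exact: norm_subMM_le u2 e1 u1 e2.
  have dom x y : `]t - 1, t + 1[%classic x -> setT y -> `|partial1of2 f x y| <= K * weight y.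
    by move=> xI _; rewrite dfE; exact: dfK.
  have K0 : 0 <= K by rewrite !mulr_ge0// expR_ge0.
  have G0 (y : 'rV[R]_n) : 0 <= K * weight y by rewrite mulr_ge0// weight_ge0.
  have intG : (lebesgue_rV R n).-integrable setT (EFin \o (fun y => K * weight y)).
    have := @integrable_weight (fun=> K) (fun x => @cst_continuous _ _ K x).
    by congr (_ .-integrable _ _); apply/funext => y /=; rewrite mulrC.
  have der x y : `]t - 1, t + 1[%classic x -> setT y -> derivable (f ^~ y) x 1.
    by move=> _ _; case: (dfP y x).
  apply: DeriveDef.
    have h := derivable_under_integral measurableT It (fun x _ => intf x) der
      G0 intG dom.
    exact: h.
  rewrite -derive1E.
  rewrite (differentiation_under_integral measurableT It (fun x _ => intf x)
    der G0 intG dom).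
  under eq_Rintegral do rewrite dfE.
  exact: green_pairing.
have := is_derive_0_is_cst s 0 FP.
by rewrite /F /f /pairing oppr0 expR0 mulr1.
Qed.
End pairing.

(** * Integrals over Euclidean balls *)

Section ball_integral.
Context {R : realType} {n : nat}.
Local Notation mu := (lebesgue_rV R n).
Implicit Types x y z : 'rV[R]_n.

Lemma eball_cube x (r : R) : eball x r `<=` cube n (enorm x + r).
Proof.
move=> y yr i; rewrite (_ : y = x + (y - x)); last by rewrite addrC subrK.
rewrite mxE; apply: le_trans (ler_normD _ _) _; apply: lerD.
  exact: coord_le_enorm.
exact: le_trans (coord_le_enorm _ _) (ltW yr).
Qed.

Lemma eball_fin x (r : R) : (mu (eball x r) < +oo)%E.
Proof.
apply: (@le_lt_trans _ _ (mu (cube n `|enorm x + r|))).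
  apply: le_measure; rewrite ?inE; [exact: measurable_eball|exact: measurable_cube|].
  by move=> y /eball_cube h i; exact: le_trans (h i) (ler_norm _).
by rewrite [X in (X < _)%E]lebesgue_rV_cube// ltry.
Qed.

Definition unit_ball_volume : R := fine (mu (eball 0 1)).

Lemma unit_ball_volume_gt0 : 0 < unit_ball_volume.
Proof.
apply: fine_gt0; rewrite eball_fin andbT.
apply: (@lt_le_trans _ _ (mu (cube n n.+1%:R^-1))).
  by rewrite [X in (_ < X)%E]lebesgue_rV_cube// lte_fin exprn_gt0// mulr_gt0.
apply: le_measure; rewrite ?inE; [exact: measurable_cube|exact: measurable_eball|].
(* The cube of half-side [1 / (n + 1)] lies in the unit ball. *)
move=> y yn; rewrite /eball/= subr0 enorm_lt// expr1n.
apply: (@le_lt_trans _ _ (\sum_(i < n) n.+1%:R^-1)).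
  apply: ler_sum => i _; rewrite -real_normK ?num_real// expr2.
  apply: (@le_trans _ _ (1 * n.+1%:R^-1)); last by rewrite mul1r.
  apply: ler_pM => //.
  by apply: le_trans (yn i) _; rewrite invf_le1// ler1n.
by rewrite sumr_const card_ord -[_ *+ n]mulr_natl ltr_pdivrMr// mul1r ltr_nat.
Qed.

Lemma integrable_eball (f : 'rV[R]_n -> R) x (r : R) : continuous f ->
  mu.-integrable (eball x r) (EFin \o f).
Proof.
move=> cf; have [M M0 fM] := bounded_on_cube f (enorm x + r) cf.
apply: measurable_bounded_integrable.
- exact: measurable_eball.
- exact: eball_fin.
- by apply: measurable_funTS; exact: continuous_measurable_rV.
- exists M; split; first exact: num_real.
  by move=> B MB y /eball_cube yr; apply: le_trans (fM _ yr) (ltW MB).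
Qed.

Lemma le_ball_integral (f g : 'rV[R]_n -> R) x x' (r r' : R) :
  continuous f -> continuous g -> (forall y, 0 <= g y) ->
  eball x r `<=` eball x' r' -> (forall y, eball x r y -> f y <= g y) ->
  \int[mu]_(y in eball x r) f y <= \int[mu]_(y in eball x' r') g y.
Proof.
move=> cf cg g0 sub fg.
apply: (@le_trans _ _ (\int[mu]_(y in eball x r) g y)).
  by apply: le_Rintegral => //; [exact: measurable_eball|exact: integrable_eball..].
apply: fine_le.
- by apply: integrable_fin_num; [exact: measurable_eball|exact: integrable_eball].
- by apply: integrable_fin_num; [exact: measurable_eball|exact: integrable_eball].
- apply: ge0_subset_integral => //; try exact: measurable_eball.
    apply: measurable_funTS; apply/measurable_EFinP.
    exact: continuous_measurable_rV.
  by move=> y _; rewrite lee_fin.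
Qed.

Lemma Rintegral_affine (f : 'rV[R]_n -> R) c (a : R) : 0 < a ->
  measurable_fun setT f -> (forall y, 0 <= f y) ->
  \int[mu]_y f y = a ^+ n * \int[mu]_y f (c + a *: y).
Proof.
move=> a0 mf f0; rewrite /Rintegral.
rewrite (@ge0_integral_affine_rV _ _ (EFin \o f) c a a0); first last.
- by move=> y; rewrite lee_fin.
- exact/measurable_EFinP.
have an0 : 0 < a ^+ n by rewrite exprn_gt0.
by rewrite /=; case: (integral _ _ _) => [t| |] //=;
  rewrite ?gt0_muley ?gt0_muleNy ?lte_fin//= mulr0.
Qed.

Lemma ball_integral_affine (f : 'rV[R]_n -> R) x (r : R) : 0 < r ->
  continuous f -> (forall y, 0 <= f y) ->
  \int[mu]_(y in eball x r) f y =
  r ^+ n * \int[mu]_(y in eball 0 1) f (x + r *: y).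
Proof.
move=> r0 cf f0; rewrite Rintegral_mkcond (@Rintegral_affine _ x r r0).
- rewrite [in RHS]Rintegral_mkcond; congr (_ * _); apply: eq_Rintegral => y _.
  rewrite !patchE; congr (if _ then _ else _).
  apply/idP/idP; rewrite !inE /eball/= subr0 addrC addKr enormZ ?ltW//.
    by rewrite -ltr_pdivlMl// mulVf// gt_eqF.
  by move=> y1; rewrite gtr_pMr.
- apply/(measurable_restrict _ _ _).1 => //; first exact: measurable_eball.
  by apply: measurable_funTS; exact: continuous_measurable_rV.
- by move=> y; rewrite patchE; case: ifP.
Qed.

Lemma measure_eball x (r : R) : 0 < r ->
  fine (mu (eball x r)) = r ^+ n * unit_ball_volume.
Proof.
move=> r0; have := @ball_integral_affine (fun=> 1) x r r0.
rewrite !Rintegral_cst ?mul1r; [|exact: measurable_eball..].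
by apply => // y; exact: cst_continuous.
Qed.

(** Unfolds the normalized mean: after scaling, every ball has the volume of the
    unit ball up to the factor [r ^ n]. *)
Lemma ball_integral_A2 (u : 'rV[R]_n -> R) x (r : R) : continuous u -> 0 < r ->
  \int[mu]_(y in eball x r) u y ^+ 2 = r ^+ n * (unit_ball_volume * A2 x r u ^+ 2).
Proof.
move=> cu r0.
have I0 : 0 <= \int[mu]_(y in eball x r) `|u y| ^+ 2.
  by apply: Rintegral_ge0 => y _; exact: sqr_ge0.
have k0 := unit_ball_volume_gt0; have rn0 : 0 < r ^+ n by rewrite exprn_gt0.
rewrite /A2 sqr_sqrtr; last first.
  by rewrite divr_ge0// measure_eball// mulr_ge0// ltW.
rewrite measure_eball//.
rewrite (_ : r ^+ n * _ = \int[mu]_(y in eball x r) `|u y| ^+ 2); last first.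
  by field; rewrite !gt_eqF.
by apply: eq_Rintegral => y _; rewrite real_normK ?num_real.
Qed.

Lemma Rintegral0_continuous (g : 'rV[R]_n -> R) :
  continuous g -> (forall y, 0 <= g y) ->
  mu.-integrable setT (EFin \o g) ->
  \int[mu]_y g y = 0 -> forall y, g y = 0.
Proof.
move=> cg g0 ig I0 z; apply/eqP; rewrite eq_le g0 andbT leNgt; apply/negP => gz.
have gz2 : g z / 2 < g z by rewrite ltr_pdivrMr// mulr_natr mulr2n ltrDl.
have /nbhs_ballP[e /= e0 ze] : \forall y \near z, g z / 2 < g y.
  exact: (cvgr_gt _ (cg z) _ gz2).
have : \int[mu]_(y in eball z e) (g z / 2) <= 0.
  rewrite -I0.
  apply: (@le_trans _ _ (\int[mu]_(y in eball z e) g y)).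
    apply: le_Rintegral => //; first exact: measurable_eball.
    - by apply: integrable_eball => y; exact: cst_continuous.
    - exact: integrable_eball.
    - move=> y ye; apply/ltW/ze; split=> // i j; rewrite ord1 /ball/= distrC.
      have := coord_le_enorm (y - z) j; rewrite !mxE => /le_lt_trans; exact.
  apply: fine_le.
  - by apply: integrable_fin_num; [exact: measurable_eball|exact: integrable_eball].
  - exact: integrable_fin_num.
  - apply: ge0_subset_integral => //; first exact: measurable_eball.
      by apply/measurable_EFinP; exact: continuous_measurable_rV.
    by move=> y _; rewrite lee_fin.
rewrite Rintegral_cst; last exact: measurable_eball.
rewrite measure_eball// leNgt mulr_gt0 ?divr_gt0//.
by rewrite mulr_gt0 ?exprn_gt0 ?unit_ball_volume_gt0.
Qed.

End ball_integral.

Lemma pow2_between {R : realType} (X : R) : 1 <= X ->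
  exists k, X <= (2 ^ k)%:R <= 2 * X.
Proof.
move=> X1.
have ex : exists k, X <= (2 ^ k)%:R.
  exists (Num.truncn X).+1; apply: le_trans (ltW (truncnS_gt X)) _.
  by rewrite ler_nat ltnW// ltn_expl.
case: (ex_minnP ex) => k Xk kmin; exists k; rewrite Xk/=.
case: k Xk kmin => [|k] Xk kmin; first by rewrite expn0; lra.
rewrite expnS natrM ler_pM2l//; apply/ltW; rewrite ltNge; apply/negP => h.
by have := kmin _ h; rewrite ltnn.
Qed.

Lemma expR_decay_lt {R : realType} (A c : R) : 0 <= A -> 0 < c ->
  exists2 K, 0 <= K & A * expR (- (2 * K)) < c.
Proof.
move=> A0 c0; exists (A / c); first by rewrite divr_ge0// ltW.
rewrite expRN ltr_pdivrMr ?expR_gt0//.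
apply: (@lt_le_trans _ _ (c * (1 + 2 * (A / c)))).
  have -> : c * (1 + 2 * (A / c)) = c + 2 * A by field; rewrite gt_eqF.
  by lra.
by rewrite ler_pM2l// expR_ge1Dx.
Qed.

(** * Log-convexity of the energy *)

Section energy.
Context {R : realType} {n : nat}.
Local Notation mu := (lebesgue_rV R n).
Variable u : 'rV[R]_n -> R.
Hypothesis hu : harmonic_on_Rn u.

Let cu : continuous u. Proof. by case: hu => -[]. Qed.

Definition energy (z : 'rV[R]_n) (r : R) : R := pairing u z r r.

(** Take [s = log (a / sqrt (a b))] in [pairing_expR]. *)
Lemma pairing_geomean z (a b : R) : 0 < a -> 0 < b ->
  pairing u z a b = energy z (Num.sqrt (a * b)).
Proof.
move=> a0 b0; set rho := Num.sqrt _.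
have ab0 : 0 < a * b by rewrite mulr_gt0.
have rho0 : 0 < rho by rewrite sqrtr_gt0.
have rho2 : rho ^+ 2 = a * b by rewrite sqr_sqrtr// ltW.
rewrite /energy -(pairing_expR u hu z rho (ln (a / rho))).
rewrite expRN lnK ?posrE ?divr_gt0//; congr pairing.
  by rewrite mulrC divfK// gt_eqF.
by rewrite invf_div mulrA -expr2 rho2 mulrAC mulfV ?mul1r// gt_eqF.
Qed.

Let cdil z (a : R) : continuous (fun y : 'rV[R]_n => u (z + a *: y)).
Proof. exact: continuous_dilate. Qed.

Let ipair z (a b : R) : mu.-integrable setT
  (EFin \o (fun y => weight y * (u (z + a *: y) * u (z + b *: y)))).
Proof. by apply: integrable_weight; apply: continuous_mulR; exact: cdil. Qed.

Lemma pairing_sqr_le z (a b : R) :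
  pairing u z a b ^+ 2 <= energy z a * energy z b.
Proof.
apply: discriminant_le => s t.
have -> : s ^+ 2 * energy z a + 2 * s * t * pairing u z a b + t ^+ 2 * energy z b
  = \int[mu]_y (weight y * (s * u (z + a *: y) + t * u (z + b *: y)) ^+ 2).
  rewrite /energy /pairing.
  have iZ c a' b' : mu.-integrable setT (EFin \o
      (fun y => c * (weight y * (u (z + a' *: y) * u (z + b' *: y))))).
    exact: (integrableZl measurableT c (ipair z a' b')).
  rewrite -!RintegralZl// -RintegralD// -RintegralD//; last first.
    exact: (integrableD measurableT (iZ _ _ _) (iZ _ _ _)).
  by apply: eq_Rintegral => y _ /=; ring.
by apply: Rintegral_ge0 => y _; rewrite mulr_ge0 ?weight_ge0 ?sqr_ge0.
Qed.

Lemma energy_ge0 z r : 0 <= energy z r.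
Proof.
by apply: Rintegral_ge0 => y _; rewrite -expr2 mulr_ge0 ?weight_ge0 ?sqr_ge0.
Qed.

(** The three-balls inequality at the geometric mean of the two radii. *)
Lemma energy_logconvex z (a b : R) : 0 < a -> 0 < b ->
  energy z (Num.sqrt (a * b)) ^+ 2 <= energy z a * energy z b.
Proof. by move=> a0 b0; rewrite -pairing_geomean//; exact: pairing_sqr_le. Qed.

(** In the logarithmic scale the radii run from [log rho - L] to [log rho], and
    each step halves the distance to the right end.  Natural powers avoid taking
    roots of an energy that may vanish. *)
Lemma energy_bisection z (rho L : R) k : 0 < rho ->
  energy z (rho * expR (- (L / (2 ^ k)%:R))) ^+ (2 ^ k) <=
  energy z (rho * expR (- L)) * energy z rho ^+ (2 ^ k).-1.
Proof.
move=> rho0; elim: k => [|k IHk].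
  by rewrite expn0 divr1 expr1 expr0 mulr1.
pose q := rho * expR (- (L / (2 ^ k)%:R)).
have q0 : 0 < q by rewrite mulr_gt0// expR_gt0.
have qE : rho * expR (- (L / (2 ^ k.+1)%:R)) = Num.sqrt (q * rho).
  rewrite -[LHS]ger0_norm ?mulr_ge0 ?expR_ge0 ?ltW// -sqrtr_sqr; congr Num.sqrt.
  have -> : q * rho = rho ^+ 2 * expR (- (L / (2 ^ k)%:R)) by rewrite /q; ring.
  rewrite exprMn -expRM_natl; congr (_ * expR _).
  by rewrite expnS natrM; field; rewrite pnatr_eq0 expn_eq0.
rewrite qE expnS exprM.
apply: (@le_trans _ _ ((energy z q * energy z rho) ^+ (2 ^ k))).
  rewrite lerXn2r ?nnegrE ?exprn_ge0 ?mulr_ge0 ?energy_ge0//.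
  exact: energy_logconvex.
rewrite exprMn.
apply: le_trans (ler_wpM2r (exprn_ge0 _ (energy_ge0 _ _)) IHk) _.
rewrite -mulrA -exprD -subn1 addnBAC ?expn_gt0//.
by rewrite mul2n addnn subn1.
Qed.

Lemma energy_le_A2 z (r : R) : 0 < r ->
  energy z r <= @unit_ball_volume R n * A2 z r u ^+ 2.
Proof.
move=> r0.
have cu2 : continuous (fun y => u y ^+ 2).
  by under eq_fun do rewrite expr2; exact: continuous_mulR.
have rn0 : 0 < r ^+ n by rewrite exprn_gt0.
rewrite -(ler_pM2l rn0) -ball_integral_A2// ball_integral_affine//; last first.
  by move=> y; exact: sqr_ge0.
rewrite ler_pM2l//.
have -> : energy z r =
    \int[mu]_(y in eball 0 1) (weight y * (u (z + r *: y) * u (z + r *: y))).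
  rewrite [RHS]Rintegral_mkcond; apply: eq_Rintegral => y _.
  rewrite patchE; case: ifPn => //; rewrite notin_setE => y1.
  by rewrite weight_out_ball// mul0r.
apply: le_ball_integral => //.
- by apply: continuous_mulR; [exact: continuous_weight|apply: continuous_mulR; exact: cdil].
- by apply: (@continuous_dilate _ _ z (fun y => u y ^+ 2)).
- by move=> y; exact: sqr_ge0.
- by move=> y _; rewrite -expr2 ler_piMl ?sqr_ge0// weight_le1.
Qed.

(** The ball of centre [z] and radius [3 |z|] lies in the ball of centre [0] and
    radius [4 |z|]. *)
Lemma A2_recenter z (s : R) : 0 < s -> enorm z = s ->
  A2 z (3 * s) u ^+ 2 <= (4 / 3) ^+ n * A2 0 (4 * s) u ^+ 2.
Proof.
move=> s0 zs.
have cu2 : continuous (fun y => u y ^+ 2).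
  by under eq_fun do rewrite expr2; exact: continuous_mulR.
have s3 : 0 < 3 * s by rewrite mulr_gt0.
have s4 : 0 < 4 * s by rewrite mulr_gt0.
have : \int[mu]_(y in eball z (3 * s)) u y ^+ 2 <=
    \int[mu]_(y in eball 0 (4 * s)) u y ^+ 2.
  apply: le_ball_integral => //; first by move=> y; exact: sqr_ge0.
  move=> y; rewrite /eball/= subr0 => yz.
  rewrite (_ : y = (y - z) + z); last by rewrite subrK.
  by apply: le_lt_trans (enormD _ _) _; rewrite zs; lra.
rewrite !ball_integral_A2// !(mulrCA _ (@unit_ball_volume R n)) ler_pM2l ?unit_ball_volume_gt0//.
move=> h; rewrite !exprMn in h.
rewrite expr_div_n mulrAC ler_pdivlMr ?exprn_gt0//.
rewrite -(ler_pM2r (exprn_gt0 n s0)); move: h.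
move: (A2 z _ u ^+ 2) (A2 0 _ u ^+ 2) => A B h.
have -> : A * 3 ^+ n * s ^+ n = 3 ^+ n * s ^+ n * A by ring.
by have -> : 4 ^+ n * B * s ^+ n = 4 ^+ n * s ^+ n * B by ring.
Qed.

(** The ball of centre [0] and radius [s] lies in the ball of centre [z] and
    radius [2 s], on which the rescaled weight is at least
    [1 - (4 / 5) ^ 2 = 9 / 25] when [rho >= 5 s / 2]. *)
Lemma A2_le_energy z (s rho : R) : 0 < s -> enorm z = s ->
  5 / 2 * s <= rho -> rho <= 3 * s ->
  @unit_ball_volume R n * A2 0 s u ^+ 2 <= 25 / 9 * 3 ^+ n * energy z rho.
Proof.
move=> s0 zs rho1 rho2.
have rho0 : 0 < rho by apply: lt_le_trans rho1; rewrite mulr_gt0.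
pose g y := 25 / 9 * (weight (rho^-1 *: (y - z)) * (u y * u y)).
have cw : continuous (fun y : 'rV[R]_n => weight (rho^-1 *: (y - z))).
  rewrite (_ : (fun y => _) = (fun y : 'rV[R]_n => weight (- (rho^-1 *: z) + rho^-1 *: y))).
    apply: continuous_dilate; exact: continuous_weight.
  by apply/funext => y; rewrite scalerBr addrC.
have cg : continuous g.
  apply: (@continuous_mulR _ _ (fun=> _)); first by move=> y; exact: cst_continuous.
  by apply: continuous_mulR => //; exact: continuous_mulR.
have cu2 : continuous (fun y => u y ^+ 2).
  by under eq_fun do rewrite expr2; exact: continuous_mulR.
have g0 y : 0 <= g y.
  by rewrite /g -expr2; apply: mulr_ge0 => //; rewrite mulr_ge0 ?weight_ge0 ?sqr_ge0.
have : \int[mu]_(y in eball 0 s) u y ^+ 2 <= \int[mu]_(y in eball z rho) g y.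
  have nyz y : eball 0 s y -> enorm (y - z) < 2 * s.
    rewrite /eball/= subr0 => ys; apply: le_lt_trans (enormD _ _) _.
    by rewrite enormN zs; lra.
  apply: le_ball_integral => // y ys; have yz := nyz y ys.
    by apply: lt_le_trans yz _; apply: le_trans rho1; lra.
  rewrite /g -expr2 mulrA ler_peMl ?sqr_ge0//.
  suff : 9 / 25 <= weight (rho^-1 *: (y - z)) by lra.
  rewrite /weight le_max; apply/orP; right.
  rewrite sqnormZ -sqr_enorm -exprMn.
  suff : rho^-1 * enorm (y - z) <= 4 / 5.
    have : 0 <= rho^-1 * enorm (y - z) by rewrite mulr_ge0 ?enorm_ge0// invr_ge0 ltW.
    by nra.
  rewrite mulrC ler_pdivrMr//; lra.
rewrite ball_integral_A2// [leRHS]ball_integral_affine//.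
have -> : \int[mu]_(y in eball 0 1) g (z + rho *: y) = 25 / 9 * energy z rho.
  rewrite Rintegral_mkcond -(RintegralZl _ measurableT (ipair z rho rho)).
  apply: eq_Rintegral => y _; rewrite patchE /g addrAC subrr add0r.
  rewrite scalerA mulVf ?gt_eqF// scale1r; case: ifPn => //; rewrite notin_setE => y1.
  by rewrite weight_out_ball// mul0r mulr0.
move=> h; rewrite -(ler_pM2l (exprn_gt0 n s0)); apply: le_trans h _.
have -> : s ^+ n * (25 / 9 * 3 ^+ n * energy z rho) =
  (3 * s) ^+ n * (25 / 9 * energy z rho) by rewrite exprMn; ring.
apply: ler_wpM2r; first by rewrite mulr_ge0 ?energy_ge0.
by rewrite lerXn2r ?nnegrE// ltW// mulr_gt0.
Qed.
End energy.

(** * Decay of the energy and unique continuation *)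

Section conclusion.
Context {R : realType} {n : nat}.
Variable u : 'rV[R]_n -> R.
Hypothesis hu : harmonic_on_Rn u.
Local Notation kap := (@unit_ball_volume R n).

Let cu : continuous u. Proof. by case: hu => -[]. Qed.

(** The hypothesis on [log eps] solved for [eps]; in this form [eps = 0], where
    the logarithm is [-oo], is no longer an exception. *)
Lemma le_expR_of_lne (T eps p K : R) : 2 <= T -> 0 <= eps ->
  (((1 / ln (2 * T)) / 100)%:E * lne eps%:E + p%:E <= (- K)%:E)%E ->
  eps <= expR (- (100 * ln (2 * T) * (K + p))).
Proof.
move=> T2 e0; have lT : 0 < ln (2 * T) by rewrite ln_gt0//; lra.
move: e0; rewrite le_eqVlt => /predU1P[<- _|e0]; first exact: expR_ge0.
move=> h0; rewrite -[eps]lnK ?posrE// ler_expR; move: h0.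
rewrite lne_EFin//.
rewrite -EFinM -EFinD lee_fin => h.
have : 1 / ln (2 * T) / 100 * ln eps <= - (K + p) by lra.
rewrite div1r -mulrA ler_pdivrMl// ler_pdivrMl//; lra.
Qed.

(** The three-balls inequality around [z], transferred to the origin.  The number
    [N] of the bisection must be large enough for the last radius to reach
    [5 / 2 |z|], and at most [100 log (2 |z| / r)] for the smallness of [eps] to
    survive an [N]-th root. *)
Lemma energy_decay (z : 'rV[R]_n) (r eps p K : R) :
  0 < 2 * r <= enorm z -> 0 <= K -> 0 <= p ->
  A2 z r u <= eps -> A2 0 (4 * enorm z) u <= p ->
  (((1 / ln (2 * enorm z / r)) / 100)%:E * lne eps%:E + p%:E <= (- K)%:E)%E ->
  energy u 0 (enorm z) <= 25 / 9 * 3 ^+ n * (2 ^+ n * kap * expR (- (2 * K))).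
Proof.
move=> /andP[r20 rz] K0 p0 Ae Ap H.
have r0 : 0 < r by rewrite pmulr_rgt0 in r20.
set s := enorm z in rz Ap H *; have s0 : 0 < s by exact: lt_le_trans rz.
pose T := s / r; have T2 : 2 <= T by rewrite /T ler_pdivlMr.
have A0 x t : 0 <= A2 x t u by exact: sqrtr_ge0.
have e0 : 0 <= eps by exact: le_trans Ae.
rewrite -(mulrA 2 s) in H; have He := le_expR_of_lne T eps p K T2 e0 H.
pose L := ln (3 * T).
have k0 := @unit_ball_volume_gt0 R n.
(* [log 6 >= 1 - 1 / 6] *)
have L56 : 5 / 6 <= L.
  have T6 : (3 * T)^-1 <= 6^-1 by rewrite lef_pV2 ?posrE//; lra.
  have T0 : 0 < (3 * T)^-1 by rewrite invr_gt0; lra.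
  have : ln (1 + ((3 * T)^-1 - 1)) <= (3 * T)^-1 - 1 by apply: le_ln1Dx; lra.
  rewrite addrC subrK lnV ?posrE; last by lra.
  by rewrite -/L; lra.
(* [3 T <= (2 T) ^ 2] *)
have LT : L <= 2 * ln (2 * T).
  rewrite /L [2 * ln _]mulr_natl -lnXn; last by lra.
  by rewrite ler_ln ?posrE; nra.
have X1 : 1 <= 6 * L by lra.
have [k /andP[k1 k2]] := pow2_between _ X1.
set N := (2 ^ k)%N in k1 k2.
have N0 : (0 < N)%N by rewrite /N expn_gt0.
have NR0 : 0 < N%:R :> R by rewrite ltr0n.
pose rho := 3 * s * expR (- (L / N%:R)).
have s3 : 0 < 3 * s by rewrite mulr_gt0.
have LN : L / N%:R <= 6^-1 by rewrite ler_pdivrMr// -ler_pdivrMl ?invr_gt0// invrK.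
(* [3 * exp (- 1 / 6) >= 3 * (5 / 6)] *)
have rho1 : 5 / 2 * s <= rho.
  have : 1 + - (L / N%:R) <= expR (- (L / N%:R)) by exact: expR_ge1Dx.
  rewrite /rho => h; have : 5 / 6 <= expR (- (L / N%:R)) by lra.
  by nra.
have rho2 : rho <= 3 * s.
  rewrite /rho ger_pMr// -expR0 ler_expR oppr_le0 divr_ge0//; lra.
have rE : 3 * s * expR (- L) = r.
  rewrite expRN lnK ?posrE; last by lra.
  by rewrite /T; field; rewrite !gt_eqF.
have Er : energy u z r <= kap * eps ^+ 2.
  apply: le_trans (energy_le_A2 _ hu z _ r0) _; rewrite ler_pM2l//.
  by rewrite lerXn2r ?nnegrE.
have ER : energy u z (3 * s) <= 2 ^+ n * kap * p ^+ 2.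
  apply: le_trans (energy_le_A2 _ hu z _ s3) _.
  rewrite (mulrC (2 ^+ n)) -mulrA ler_pM2l//.
  apply: le_trans (A2_recenter _ hu z _ s0 erefl) _.
  apply: ler_pM; rewrite ?exprn_ge0 ?sqr_ge0//; last by rewrite lerXn2r ?nnegrE.
  by rewrite lerXn2r ?nnegrE//; lra.
have EN := energy_bisection u hu z (3 * s) L k s3; rewrite -/N rE -/rho in EN.
have cn1 : 1 <= 2 ^+ n :> R by rewrite exprn_ege1// ler1n.
(* With [c = 2 ^ n * unit_ball_volume], the two factors of [EN] are at most
   [c * E1 ^ N] and [(c * E2) ^ (N - 1)], where [E1 * E2 = exp (- 2 K)]. *)
have goalN : energy u z rho <= 2 ^+ n * kap * expR (- (2 * K)).
  rewrite -(@ler_pXn2r _ N) ?nnegrE ?energy_ge0//; last first.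
    by rewrite mulr_ge0 ?expR_ge0// mulr_ge0 ?exprn_ge0// ltW.
  apply: le_trans EN _.
  set c := 2 ^+ n * kap.
  have kc : kap <= c by rewrite /c ler_peMl// ltW.
  have c0 : 0 < c by exact: lt_le_trans kc.
  pose E1 := expR (- (2 * (K + p))); pose E2 := expR (2 * p).
  have E10 : 0 < E1 by exact: expR_gt0.
  have E21 : 1 <= E2 by rewrite /E2 -expR0 ler_expR mulr_ge0.
  have Er' : energy u z r <= c * E1 ^+ N.
    apply: le_trans Er _; apply: ler_pM; [exact: ltW|exact: sqr_ge0|by []|].
    apply: (@le_trans _ _ (expR (- (100 * ln (2 * T) * (K + p))) ^+ 2)).
      by rewrite lerXn2r ?nnegrE ?expR_ge0.
    rewrite /E1 -!expRM_natl ler_expR.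
    have : N%:R * (K + p) <= 100 * ln (2 * T) * (K + p).
      by apply: ler_wpM2r; [rewrite addr_ge0|lra].
    by lra.
  have ER' : energy u z (3 * s) <= c * E2.
    apply: le_trans ER _; rewrite ler_pM2l// /E2 expRM_natl.
    rewrite lerXn2r ?nnegrE ?expR_ge0//.
    by apply: le_trans (expR_ge1Dx p); rewrite lerDr.
  apply: (@le_trans _ _ (c * E1 ^+ N * (c * E2) ^+ N.-1)).
    apply: ler_pM; rewrite ?exprn_ge0 ?energy_ge0//.
    by rewrite lerXn2r ?nnegrE ?energy_ge0// mulr_ge0 ?ltW// (lt_le_trans _ E21).
  have -> : expR (- (2 * K)) = E1 * E2.
    by rewrite /E1 /E2 -expRD; congr expR; ring.
  clearbody c; rewrite -[in leRHS](prednK N0) exprS !exprMn.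
  have -> : c * E1 ^+ N = c * E1 * E1 ^+ N.-1.
    by rewrite -[in LHS](prednK N0) exprS mulrA.
  have -> : c * (E1 * E2) * (c ^+ N.-1 * (E1 ^+ N.-1 * E2 ^+ N.-1)) =
    E2 * (c * E1 * E1 ^+ N.-1 * (c ^+ N.-1 * E2 ^+ N.-1)) by ring.
  rewrite ler_peMl// !mulr_ge0 ?exprn_ge0 ?ltW//; exact: lt_le_trans E21.
apply: (@le_trans _ _ (kap * A2 0 s u ^+ 2)); first exact: energy_le_A2.
apply: le_trans (A2_le_energy _ hu z s rho s0 erefl rho1 rho2) _.
by rewrite ler_pM2l// mulr_gt0// exprn_gt0.
Qed.

(** Unique continuation: by log-convexity, a zero of the energy at one radius
    forces zeros at all radii. *)
Lemma energy_eq0_all (z : 'rV[R]_n) (d : R) : 0 < d -> energy u z d = 0 ->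
  forall y, u y = 0.
Proof.
move=> d0 Ed y.
pose rho := 2 * (enorm (y - z) + 1).
have e0 := enorm_ge0 (y - z).
have rho0 : 0 < rho by rewrite /rho; lra.
have Er : energy u z rho = 0.
  have := energy_logconvex u hu z d (rho ^+ 2 / d) d0.
  rewrite divr_gt0 ?exprn_gt0// => /(_ isT).
  rewrite mulrC divfK ?gt_eqF// sqrtr_sqr gtr0_norm// Ed mul0r => h.
  by apply/eqP; rewrite -sqrf_eq0 eq_le h sqr_ge0.
pose g (y : 'rV[R]_n) := weight y * (u (z + rho *: y) * u (z + rho *: y)).
have cr : continuous (fun y : 'rV[R]_n => u (z + rho *: y)) by exact: continuous_dilate.
have cr2 : continuous (fun y : 'rV[R]_n => u (z + rho *: y) * u (z + rho *: y)).
  exact: continuous_mulR.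
have cg : continuous g by apply: continuous_mulR => //; exact: continuous_weight.
have g0 x : 0 <= g x by rewrite /g -expr2 mulr_ge0 ?weight_ge0 ?sqr_ge0.
have := Rintegral0_continuous g cg g0 (integrable_weight _ cr2) Er (rho^-1 *: (y - z)).
rewrite /g scalerA mulfV ?gt_eqF// scale1r [z + _]addrC subrK => /eqP.
rewrite mulf_eq0 mulf_eq0 orbb => /orP[|/eqP//].
rewrite gt_eqF// /weight lt_max; apply/orP; right.
rewrite subr_gt0 -[1](expr1n _ 2) -enorm_lt// enormZ ?invr_ge0 ?ltW//.
by rewrite ltr_pdivrMl// mulr1 /rho; lra.
Qed.

(** Bounds the first factor of [E d ^ 2 <= E (d^2 / |x_m|) * E |x_m|] uniformly in
    [m]. *)
Lemma energy_bounded (d : R) :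
  exists2 B, 0 <= B & forall t, 0 < t -> t <= d -> energy u 0 t <= B.
Proof.
have [B B0 uB] := bounded_on_cube u d cu.
have k0 := @unit_ball_volume_gt0 R n.
exists (kap * B ^+ 2) => [|t t0 td]; first by rewrite mulr_ge0 ?sqr_ge0// ltW.
apply: le_trans (energy_le_A2 _ hu 0 _ t0) _.
have tn0 : 0 < t ^+ n by rewrite exprn_gt0.
rewrite -(ler_pM2l tn0) -ball_integral_A2//.
have -> : t ^+ n * (kap * B ^+ 2) = \int[lebesgue_rV R n]_(y in eball 0 t) (B ^+ 2).
  by rewrite Rintegral_cst ?measure_eball//; [ring|exact: measurable_eball].
apply: le_ball_integral => //.
- by under eq_fun do rewrite expr2; exact: continuous_mulR.
- by move=> y; exact: cst_continuous.
- by move=> y; exact: sqr_ge0.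
- move=> y; rewrite /eball/= subr0 => yt.
  rewrite -real_normK ?num_real// lerXn2r ?nnegrE//; apply: uB => i.
  exact: le_trans (coord_le_enorm _ _) (le_trans (ltW yt) td).
Qed.

End conclusion.

Lemma not_cvg0_enorm {R : realType} {n : nat} (x : nat -> 'rV[R]_n) :
  ~ (x @ \oo --> (0 : 'rV[R]_n)) ->
  exists2 d : R, 0 < d & forall M, exists2 m, (M <= m)%N & d <= enorm (x m).
Proof.
move=> hx; apply: contrapT => h; apply: hx; apply/cvg_ballP => e e0.
have [M HM] : exists M, forall m, (M <= m)%N -> enorm (x m) < e.
  apply: contrapT => h2; apply: h; exists e => // M.
  apply: contrapT => h3; apply: h2; exists M => m Mm; rewrite ltNge; apply/negP => em.
  by apply: h3; exists m.
exists M => // m /= Mm; split=> // i j; rewrite ord1 /ball/= mxE sub0r normrN.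
exact: le_lt_trans (coord_le_enorm _ _) (HM m Mm).
Qed.

(* hx excludes exactly x_m -> 0, where the claim fails: u = first coordinate,
   phi(r) = r, |x_m| = exp(-m)/2, r_m = |x_m|/2, eps_m = exp(-m).
   lne is the extended logarithm, with lne 0 = -oo. *)
Theorem theorem3 (R : realType) (n : nat) (u : 'rV[R]_n -> R) (phi : R -> R)
    (x : nat -> 'rV[R]_n) (r eps : nat -> R)
    (hn : (2 <= n)%N)
    (hu : harmonic_on_Rn u)
    (hphi : forall s t : R, 0 <= s -> s <= t -> phi s <= phi t)
    (hA : forall s : R, 0 < s -> A2 0 s u <= phi s)
    (hr : forall m, 0 < 2 * r m <= enorm (x m))
    (heps : forall m, A2 (x m) (r m) u <= eps m)
    (hx : ~ (x @ \oo --> (0 : 'rV[R]_n)))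
    (hlim : (fun m : nat =>
        let rho := 1 / ln (2 * enorm (x m) / r m) in
        ((rho / 100)%:E * lne (eps m)%:E + (phi (4 * enorm (x m)))%:E)%E)
      @ \oo --> -oo%E) :
  forall y, u y = 0.
Proof.
have [d d0 xd] := not_cvg0_enorm x hx.
have k0 := @unit_ball_volume_gt0 R n.
have [B B0 uB] := energy_bounded u hu d.
apply: (energy_eq0_all u hu 0 d d0).
apply/eqP; rewrite -sqrf_eq0 eq_le sqr_ge0 andbT leNgt; apply/negP => Ed.
(* A positive energy at [d] would exceed [B * C * exp (- 2 K)] for some [K], against
   log-convexity between the radii [d ^ 2 / |x m|] and [|x m|]. *)
set C := 25 / 9 * 3 ^+ n * (2 ^+ n * @unit_ball_volume R n).
have C0 : 0 <= C by rewrite /C !mulr_ge0 ?exprn_ge0// ltW.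
have BC : 0 <= B * C by rewrite !mulr_ge0// ?sqr_ge0// ltW.
have [K K0 KE] := expR_decay_lt _ _ BC Ed.
have [M _ HM] := cvgeNy_le hlim (- K).
have [m Mm dm] := xd M.
have := HM m Mm; rewrite /= => H.
have s0 : 0 < enorm (x m) by exact: lt_le_trans dm.
have s4 : 0 < 4 * enorm (x m) by rewrite mulr_gt0.
have p0 : 0 <= phi (4 * enorm (x m)).
  by apply: le_trans (hA _ s4); exact: sqrtr_ge0.
have Em := energy_decay u hu _ _ _ _ _ (hr m) K0 p0 (heps m) (hA _ s4) H.
have t0 : 0 < d ^+ 2 / enorm (x m) by rewrite divr_gt0// exprn_gt0.
have td : d ^+ 2 / enorm (x m) <= d.
  by rewrite ler_pdivrMr// expr2 ler_pM2l.
have := energy_logconvex u hu 0 _ _ t0 s0; rewrite divfK ?gt_eqF// sqrtr_sqr gtr0_norm//.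
apply/negP; rewrite -ltNge; apply: le_lt_trans KE.
rewrite -[leRHS]mulrA; apply: ler_pM; rewrite ?energy_ge0//; first exact: uB.
by rewrite /C -[leRHS]mulrA.
Qed.
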